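(* Fix $u_m>0$. There exists a constant $c>0$ such that $$\mathcal D_{S,f_0}^{0}[U^S;\phi]\ge c\left(u_m\int_{\mathbb R}\phi_\xi^2\,d\xi+\int_{\mathbb R}U^S_\xi\left(u_m^2\phi^2+\phi^4\right)d\xi\right)$$ for any $\phi\in H^1(\mathbb R)$.
   Context: $f_0(u)=u^3$. $U^S:\mathbb R\to(-2u_m,u_m)$ is the viscous shock profile for $f_0$: the solution of $U^S_\xi=(U^S+2u_m)(U^S-u_m)^2$ with $U^S(-\infty)=-2u_m$, $U^S(+\infty)=u_m$, $U^S(0)=-u_m/2$. For $\phi\in H^1(\mathbb R)$, $$\begin{aligned}\mathcal D_{S,f_0}^{0}[U^S;\phi]:={}&\int_{\mathbb R}(5u_m-U^S)\phi_\xi^2\,d\xi+\int_{\mathbb R}U^S_\xi\left((15u_mU^S-3u_m^2)\phi^2+(5u_m+U^S)\phi^3+\tfrac34\phi^4\right)d\xi\\&+\frac5{u_m}\left(\int_{\mathbb R}U^S_\xi\left((5u_m-U^S)\phi+\tfrac12\phi^2\right)d\xi\right)^2.\end{aligned}$$ *)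

(* Defs.v *)
From HB Require Import structures.
From mathcomp Require Import all_boot all_order all_algebra.
From mathcomp Require Import all_classical all_reals all_analysis.

Set Implicit Arguments.
Unset Strict Implicit.
Unset Printing Implicit Defensive.

Import Order.TTheory GRing.Theory Num.Theory.
Import numFieldNormedType.Exports.

Local Open Scope ring_scope.
Local Open Scope classical_set_scope.

Definition is_test_function (R : realType) (eta : R -> R) : Prop :=
  (forall (n : nat) (x : R), derivable eta^`(n) x 1) /\
  (exists M : R, forall x : R, M < `|x| -> eta x = 0).

Definition is_weak_derivative (R : realType) (phi dphi : R -> R) : Prop :=
  forall eta : R -> R, is_test_function eta ->
    \int[lebesgue_measure]_x (phi x * eta^`()%classic x) =
    - \int[lebesgue_measure]_x (dphi x * eta x).

(* [is_H1 phi dphi]: [phi] represents an element of the Sobolev space H^1(R)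
   and [dphi] represents its weak derivative, which is unique only almost
   everywhere and hence cannot be a function of [phi]. Neither representative
   is assumed to have any pointwise regularity. *)
Definition is_H1 (R : realType) (phi dphi : R -> R) : Prop :=
  [/\ phi \in Lfun (@lebesgue_measure R) 2%:E,
      dphi \in Lfun (@lebesgue_measure R) 2%:E &
      is_weak_derivative phi dphi].

(* The viscous shock profile for the flux u ^ 3 joining -2 um to um. *)
Definition is_shock_profile (R : realType) (um : R) (U : R -> R) : Prop :=
  [/\ (forall x : R, - 2 * um < U x < um),
      (forall x : R, derivable U x 1 /\
         U^`() x = (U x + 2 * um) * (U x - um) ^+ 2),
      U x @[x --> -oo] --> - 2 * um,
      U x @[x --> +oo] --> um &
      U 0 = - um / 2].

Definition dissipation0 (R : realType) (um : R) (U phi dphi : R -> R) : R :=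
  \int[lebesgue_measure]_x ((5 * um - U x) * dphi x ^+ 2)
  + \int[lebesgue_measure]_x
      (U^`()%classic x * ((15 * um * U x - 3 * um ^+ 2) * phi x ^+ 2
                  + (5 * um + U x) * phi x ^+ 3
                  + 3 / 4 * phi x ^+ 4))
  + 5 / um *
    (\int[lebesgue_measure]_x
       (U^`()%classic x * ((5 * um - U x) * phi x + 1 / 2 * phi x ^+ 2))) ^+ 2.

(* Main.v *)
(* Normalize u = U / um, w = phi / um and k = um^2, so that u' = k (u + 2) (1 - u)^2.
   Dividing by um^5 and writing du for u' dx, the dissipation becomes
     1/k int (5 - u) w_x^2 dx + int P(u, w) du + 5 (int q(u, w) du)^2
   with P = (15 u - 3) w^2 + (5 + u) w^3 + 3/4 w^4 and q = (5 - u) w + w^2 / 2.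
   Let m be the value of w at the point where u = -4/5, and let z = w - m.
   Since z vanishes there, the gradient term controls int N(u) z^2 du for a suitable
   weight N (mixing_weight): on each side of that point one adds the exact derivative of
   g(u) z^2, where g is a subsolution of the Riccati equation g' = g^2 / A + N with
   A = (5 - u) (u + 2) (1 - u)^2, and completes the square. The left g and the right g need
   not match, as z = 0. The squared term is bounded below by 10 m I - 5 m^2, I = int q du.
   What remains is pointwise: P + 10 m q + N z^2 is a sum of squares plus r(u) m^2
   (r = mean_density), and the integral of r exceeds 5.
   Elements of H^1 are first replaced by the primitive of their weak derivative
   (du Bois-Reymond, with the smooth bumps exp(-1/x)); all integrations by parts for such
   primitives are instances of Fubini's theorem. *)
Require Import Defs.
From HB Require Import structures.
From mathcomp Require Import all_boot all_order all_algebra.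
From mathcomp Require Import all_classical all_reals all_analysis.
From mathcomp Require Import measurable_realfun ring lra.
Import Order.TTheory GRing.Theory Num.Theory.
Import numFieldNormedType.Exports.
Local Open Scope ring_scope.
Local Open Scope classical_set_scope.

Set Implicit Arguments.
Unset Strict Implicit.
Unset Printing Implicit Defensive.

(** * Real-valued integrals over the line *)

(** The obstacle is that [P] takes negative values at every u in ]-2, 1[: completing the square in
    the quartic leaves -(1 - u)(34 - u)/3 w^2, attained at w = -2(5 + u)/3. No pointwise bound on
    [P] alone can work, and the gradient only sees the deviation z, so the constant m has to be paid
    for by the squared integral. That term is nonlocal and quartic; replacing it by its tangent 10 m
    I - 5 m^2, which discards 5 (I - m)^2, makes it linear in I and hence an integral of a local
    density. With slope 10 m, the term 5 m w^2 of 10 m q fits into the same square as the cubic term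
    of [P]. The budget in m is then: the integral of r is 13/2, the tangent costs 5, and the
    remaining 3/2 is m^2/2 for each unit of the total mass 3 of du. This remainder, with the 2/25 of
    room in N, gives coercivity. Integrability is a separate concern. The derivative is in L^2 but
    perhaps not in L^1 of the line, so the calibration is proved for truncated derivatives first;
    cubic and quartic integrals converge because w is bounded and du is a finite measure. *)

Definition integrableR (R : realType) (f : R -> R) : Prop :=
  (@lebesgue_measure R).-integrable setT (EFin \o f).

Section toolkit.
Context {R : realType}.
Local Notation mu := (@lebesgue_measure R).
Implicit Types (f g h : R -> R).

Lemma integrableR_measurable f : integrableR f -> measurable_fun setT f.
Proof. by move=> /integrableP[/measurable_EFinP]. Qed.

Lemma integrableRD f g : integrableR f -> integrableR g ->
  integrableR (fun x => f x + g x).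
Proof. by move=> fi gi; exact: (integrableD measurableT fi gi). Qed.

Lemma integrableRZ (c : R) f : integrableR f -> integrableR (fun x => c * f x).
Proof. by move=> fi; exact: (integrableZl measurableT c fi). Qed.

Lemma integrableRN f : integrableR f -> integrableR (fun x => - f x).
Proof.
move=> fi; under eq_fun do rewrite -mulN1r.
exact: integrableRZ.
Qed.

Lemma integrableRB f g : integrableR f -> integrableR g ->
  integrableR (fun x => f x - g x).
Proof. by move=> fi gi; apply: integrableRD => //; exact: integrableRN. Qed.

Lemma integrableR_le f g : measurable_fun setT f ->
  (forall x, `|f x| <= g x) -> integrableR g -> integrableR f.
Proof.
move=> mf fg; apply: le_integrable => //; first exact/measurable_EFinP.
by move=> x _ /=; rewrite lee_fin (le_trans (fg x))// ler_norm.
Qed.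

Lemma integrableR_norm f : integrableR f -> integrableR (fun x => `|f x|).
Proof. by move=> fi; exact: integrable_norm. Qed.

Lemma integrableR_boundedM (b : R -> R) (M : R) f : measurable_fun setT b ->
  (forall x, `|b x| <= M) -> integrableR f -> integrableR (fun x => b x * f x).
Proof.
move=> mb bM fi; have mf := integrableR_measurable fi.
apply: (@integrableR_le _ (fun x => M * `|f x|)).
- exact: measurable_funM.
- by move=> x; rewrite normrM ler_wpM2r.
- exact/integrableRZ/integrableR_norm.
Qed.

Lemma RintD f g : integrableR f -> integrableR g ->
  \int[mu]_x (f x + g x) = \int[mu]_x f x + \int[mu]_x g x.
Proof. by move=> fi gi; rewrite RintegralD. Qed.

Lemma RintB f g : integrableR f -> integrableR g ->
  \int[mu]_x (f x - g x) = \int[mu]_x f x - \int[mu]_x g x.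
Proof. by move=> fi gi; rewrite RintegralB. Qed.

Lemma RintZ (c : R) f : integrableR f ->
  \int[mu]_x (c * f x) = c * \int[mu]_x f x.
Proof. by move=> fi; rewrite RintegralZl. Qed.

Lemma RintN f : integrableR f -> \int[mu]_x (- f x) = - \int[mu]_x f x.
Proof.
move=> fi; rewrite -mulN1r -RintZ//.
by apply: eq_Rintegral => x _; rewrite mulN1r.
Qed.

Lemma Rint_le f g : integrableR f -> integrableR g ->
  (forall x, f x <= g x) -> \int[mu]_x f x <= \int[mu]_x g x.
Proof. by move=> fi gi fg; apply: le_Rintegral. Qed.

Lemma EFin_Rint f : integrableR f ->
  (\int[mu]_x f x)%:E = (\int[mu]_x (f x)%:E)%E.
Proof. by move=> fi; rewrite /Rintegral fineK//; exact: integrable_fin_num. Qed.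

Lemma Rint_ae f g : measurable_fun setT f -> measurable_fun setT g ->
  {ae mu, forall x, f x = g x} -> \int[mu]_x f x = \int[mu]_x g x.
Proof.
move=> mf mg fg; congr fine; apply: ae_eq_integral => //.
- exact/measurable_EFinP.
- exact/measurable_EFinP.
- move: fg; apply: filterS; first exact: (ae_filter_ringOfSetsType mu).
  by move=> x /= -> _.
Qed.

Lemma Rint_dominated_cvg (f_ : (R -> R)^nat) f g :
  (forall n, measurable_fun setT (f_ n)) -> measurable_fun setT f ->
  (forall x, f_ ^~ x @ \oo --> f x) -> integrableR g ->
  (forall n x, `|f_ n x| <= g x) ->
  (\int[mu]_x f_ n x) @[n --> \oo] --> \int[mu]_x f x.
Proof.
move=> mf_ mf ff gi fg.
have fi : integrableR f.
  apply: (integrableR_le mf _ gi) => x.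
  apply: (@ler_cvg_to _ \oo _ _ (fun n => `|f_ n x|) (fun=> g x)).
  - by apply: cvg_norm; exact: ff.
  - exact: cvg_cst.
  - by apply: nearW => n.
have [] := @dominated_convergence _ _ _ mu setT measurableT
  (fun n => EFin \o f_ n) (EFin \o f) (EFin \o g).
- move=> n. apply/measurable_EFinP. exact: mf_.
- exact/measurable_EFinP.
- by apply: aeW => x _; apply: cvg_EFin; [exact: nearW|exact: ff].
- exact: gi.
- by apply: aeW => x n _ /=; rewrite lee_fin.
move=> _ _ h; apply: fine_cvg; rewrite EFin_Rint//; exact: h.
Qed.

End toolkit.

(** * Fubini's theorem for bounded kernels *)

Section kernel.
Context {R : realType}.
Local Notation mu := (@lebesgue_measure R).
Local Notation RT := (measurableTypeR R).
Implicit Types (f g h : R -> R) (K : RT * RT -> R).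

Lemma integrableR_section K h (x : R) : measurable_fun setT K ->
  (forall p, `|K p| <= 1) -> integrableR h -> integrableR (fun y => K (x, y) * h y).
Proof.
move=> mK K1 hi; apply: (@integrableR_boundedM _ _ 1) => //.
exact: measurableT_comp.
Qed.

Lemma measurable_kernel K h : measurable_fun setT K -> measurable_fun setT h ->
  measurable_fun setT (fun x : R => \int[mu]_y (K (x, y) * h y)).
Proof.
move=> mK mh; pose F (p : RT * RT) := (K p * h p.2)%:E.
have mF : measurable_fun setT F.
  by apply/measurable_EFinP; apply: measurable_funM => //; exact: measurableT_comp.
rewrite /Rintegral; apply: measurableT_comp => //.
(* Tonelli gives measurability of the partial integral of a nonnegative function, so the positive
   and negative parts are treated separately. *)
rewrite [X in measurable_fun _ X](_ : _ = (fun x => \int[mu]_y F^\+ (x, y)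
    - \int[mu]_y F^\- (x, y))%E); last first.
  apply/funext => x; rewrite [LHS]integralE.
  by congr (_ - _)%E; apply: eq_integral => y _; rewrite ?funeposE ?funenegE.
apply: emeasurable_funB.
- by apply: (measurable_fun_fubini_tonelli_F F^\+%E) => //; exact: measurable_funepos.
- by apply: (measurable_fun_fubini_tonelli_F F^\-%E) => //; exact: measurable_funeneg.
Qed.

Lemma kernel_bound K h (x : R) : measurable_fun setT K ->
  (forall p, `|K p| <= 1) -> integrableR h ->
  `|\int[mu]_y (K (x, y) * h y)| <= \int[mu]_y `|h y|.
Proof.
move=> mK K1 hi; have Khi := integrableR_section x mK K1 hi.
apply: (le_trans (le_normr_Rintegral measurableT Khi)).
apply: Rint_le; [exact: integrableR_norm|exact: integrableR_norm|].
by move=> y; rewrite normrM ler_piMl.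
Qed.

Lemma fubini_kernel K f h : measurable_fun setT K ->
  (forall p, `|K p| <= 1) -> integrableR f -> integrableR h ->
  \int[mu]_x (f x * \int[mu]_y (K (x, y) * h y)) =
  \int[mu]_y (h y * \int[mu]_x (K (x, y) * f x)).
Proof.
move=> mK K1 fi hi; have mf := integrableR_measurable fi.
have mh := integrableR_measurable hi.
pose F (p : RT * RT) := (f p.1 * K p * h p.2)%:E.
have mF : measurable_fun setT F.
  apply/measurable_EFinP; apply: measurable_funM; last exact: measurableT_comp.
  by apply: measurable_funM => //; exact: measurableT_comp.
have iF : (mu \x mu)%E.-integrable setT F.
  apply/(integrable12ltyP _ _ mF).
  apply: (@le_lt_trans _ _ (\int[mu]_x (`|f x| * \int[mu]_y `|h y|)%:E)%E).
    apply: ge0_le_integral => //.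
    - by move=> x _; apply: integral_ge0.
    - apply: (measurable_fun_fubini_tonelli_F (abse \o F)); last first.
        by move=> p; exact: abse_ge0.
      exact: (measurableT_comp (@abse_measurable _ _) mF).
    - apply/(measurableT_comp (@EFin_measurable _ _))/measurable_funM => //.
      exact: measurableT_comp.
    - move=> x _; rewrite -RintZ; last exact: integrableR_norm.
      rewrite EFin_Rint; last exact/integrableRZ/integrableR_norm.
      apply: ge0_le_integral => //.
      + apply: measurableT_comp => //.
        exact: (measurableT_comp mF (@pair1_measurable _ _ RT RT x)).
      + apply: measurableT_comp => //; apply: measurable_funM => //.
        exact: measurableT_comp.
      + move=> y _; rewrite /F/= lee_fin !normrM ler_wpM2r//.
        by rewrite ler_piMr.
  under eq_integral do rewrite mulrC.
  rewrite -EFin_Rint ?ltry//.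
  exact/integrableRZ/integrableR_norm.
have -> : \int[mu]_x (f x * \int[mu]_y (K (x, y) * h y)) =
    fine (\int[mu]_x \int[mu]_y F (x, y))%E.
  congr fine; apply: eq_integral => x _.
  rewrite -RintZ; last exact: integrableR_section.
  rewrite EFin_Rint; last exact/integrableRZ/integrableR_section.
  by apply: eq_integral => y _; rewrite /F/= mulrA.
have -> : \int[mu]_y (h y * \int[mu]_x (K (x, y) * f x)) =
    fine (\int[mu]_y \int[mu]_x F (x, y))%E.
  have Kfi y : integrableR (fun x => K (x, y) * f x).
    apply: (@integrableR_boundedM _ _ 1) => //; exact: measurableT_comp.
  congr fine; apply: eq_integral => y _.
  rewrite -RintZ// EFin_Rint; last exact/integrableRZ.
  by apply: eq_integral => x _; rewrite /F/=; congr EFin; ring.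
by congr fine; rewrite (Fubini iF).
Qed.

End kernel.

(** * Primitives of integrable functions *)

(* [oriented_indic a x] is the indicator of [a, x[ if a <= x and minus that of
   [x, a[ otherwise, so that [primitive a h x] is the oriented integral of [h]
   from [a] to [x]. *)
Definition oriented_indic (R : realType) (a x y : R) : R :=
  (y < x)%R%:R - (y < a)%R%:R.

Definition primitive (R : realType) (a : R) (h : R -> R) (x : R) : R :=
  \int[lebesgue_measure]_y (oriented_indic a x y * h y).

Section primitive.
Context {R : realType}.
Local Notation mu := (@lebesgue_measure R).
Local Notation RT := (measurableTypeR R).
Implicit Types (f g h : R -> R).

Lemma measurable_indic_lt d (T : measurableType d) (f g : T -> R) :
  measurable_fun setT f -> measurable_fun setT g ->
  measurable_fun setT (fun x => (f x < g x)%R%:R : R).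
Proof.
move=> mf mg; rewrite (_ : (fun x => _) = \1_[set x | f x < g x]); last first.
  by apply/funext => x; rewrite indicE; congr (nat_of_bool _)%:R;
    apply/idP/idP; rewrite inE.
apply: measurable_indic.
have := measurable_fun_ltr mf mg; rewrite /measurable_fun => /(_ measurableT).
by move=> /(_ [set true] I); rewrite setTI.
Qed.

Lemma measurable_oriented_indic (a : R) :
  measurable_fun setT (fun p : RT * RT => oriented_indic a p.1 p.2).
Proof.
apply: measurable_funB.
  exact: (measurable_indic_lt measurable_snd measurable_fst).
exact: (measurable_indic_lt measurable_snd (measurable_cst a)).
Qed.

Lemma measurable_oriented_indic2 (a x : R) :
  measurable_fun setT (oriented_indic a x).
Proof.
apply: measurable_funB.
  exact: (@measurable_indic_lt _ RT id (cst x)).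
exact: (@measurable_indic_lt _ RT id (cst a)).
Qed.

Lemma normr_oriented_indic (a x y : R) : `|oriented_indic a x y| <= 1.
Proof.
rewrite /oriented_indic.
by case: (y < x)%R; case: (y < a)%R;
  rewrite ?subrr ?subr0 ?sub0r ?normrN ?normr1 ?normr0 ?lexx ?ler01.
Qed.

Lemma integrableR_oriented (a x : R) h : integrableR h ->
  integrableR (fun y => oriented_indic a x y * h y).
Proof.
move=> hi; apply: (@integrableR_boundedM _ _ 1) => //.
  exact: measurable_oriented_indic2.
by move=> y; exact: normr_oriented_indic.
Qed.

Lemma integrableR_lt (x : R) h : integrableR h ->
  integrableR (fun y => (y < x)%R%:R * h y).
Proof.
move=> hi; apply: (@integrableR_boundedM _ _ 1) => //.
  exact: (@measurable_indic_lt _ RT id (cst x)).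
by move=> y; case: ltP => _; rewrite ?normr1 ?normr0.
Qed.

Lemma ae_neq (y : R) : {ae mu, forall x, x != y}.
Proof.
exists [set y]; split => //; first exact: lebesgue_measure_set1.
by move=> x /= /negP; rewrite negbK => /eqP.
Qed.

(** Fubini exchanges the triangle y < x with the triangle x < y; the two copies fill the square up
    to the diagonal, which is null. *)
Lemma double_Rint_lt h : integrableR h ->
  \int[mu]_x (h x * \int[mu]_y ((y < x)%R%:R * h y)) *+ 2 = (\int[mu]_x h x) ^+ 2.
Proof.
move=> hi; have mh := integrableR_measurable hi.
have mL : measurable_fun setT (fun p : RT * RT => (p.2 < p.1)%R%:R : R).
  exact: (measurable_indic_lt measurable_snd measurable_fst).
have L1 (p : RT * RT) : `|(p.2 < p.1)%R%:R : R| <= 1.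
  by case: ltP => _; rewrite ?normr1 ?normr0.
have Hi : integrableR (fun x => h x * \int[mu]_y ((y < x)%R%:R * h y)).
  under eq_fun do rewrite mulrC.
  apply: (@integrableR_boundedM _ _ (\int[mu]_y `|h y|)) => //.
    exact: (measurable_kernel mL mh).
  by move=> x; exact: (kernel_bound x mL L1 hi).
rewrite mulr2n {2}(fubini_kernel mL L1 hi hi)/=.
have -> : \int[mu]_y (h y * \int[mu]_x ((y < x)%R%:R * h x)) =
    \int[mu]_y ((\int[mu]_x h x) * h y - h y * \int[mu]_x ((x < y)%R%:R * h x)).
  apply: eq_Rintegral => y _; rewrite [X in _ = X - _]mulrC -mulrBr; congr (_ * _).
  rewrite -RintB//; last exact: integrableR_lt.
  apply: Rint_ae.
  - apply: measurable_funM => //.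
    exact: (@measurable_indic_lt _ RT (cst y) id).
  - apply: measurable_funB => //.
    apply: measurable_funM => //.
    exact: (@measurable_indic_lt _ RT id (cst y)).
  - have := ae_neq y; apply: filterS; first exact: (ae_filter_ringOfSetsType mu).
    by move=> x /= xy; case: ltgtP xy => //= _ _; ring.
rewrite RintB//; last exact: integrableRZ.
by rewrite RintZ// addrC subrK.
Qed.

Lemma measurable_primitive (a : R) h : measurable_fun setT h ->
  measurable_fun setT (primitive a h).
Proof. exact: (measurable_kernel (measurable_oriented_indic a)). Qed.

Lemma primitive_bound (a x : R) h : integrableR h ->
  `|primitive a h x| <= \int[mu]_y `|h y|.
Proof.
apply: (kernel_bound x (measurable_oriented_indic a)) => p.
exact: normr_oriented_indic.
Qed.

(* The product rule (z^2)' = 2 z z' for the absolutely continuous function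
   z = primitive a h. *)
Lemma sqr_primitive (a x : R) h : integrableR h ->
  primitive a h x ^+ 2 = primitive a (fun y => 2 * primitive a h y * h y) x.
Proof.
move=> hi; set z := primitive a h.
have mh := integrableR_measurable hi.
pose k y := oriented_indic a x y * h y.
have ki : integrableR k by exact: integrableR_oriented.
have zhi : integrableR (fun y => z y * h y).
  apply: (@integrableR_boundedM _ _ (\int[mu]_y `|h y|)) => //.
    exact: measurable_primitive.
  by move=> y; exact: primitive_bound.
have -> : primitive a (fun y => 2 * z y * h y) x = 2 * primitive a (fun y => z y * h y) x.
  rewrite /primitive -RintZ; last exact: integrableR_oriented.
  by apply: eq_Rintegral => y _; ring.
have := double_Rint_lt ki; rewrite -[\int[mu]_x k x]/(z x).
have [ax|xa] := leP a x.
- have -> : \int[mu]_s (k s * \int[mu]_t ((t < s)%R%:R * k t)) =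
      primitive a (fun y => z y * h y) x.
    apply: eq_Rintegral => s _; rewrite /k -mulrA.
    have [->|s0] := eqVneq (oriented_indic a x s) 0; first by rewrite !mul0r.
    congr (_ * _); rewrite mulrC; congr (_ * _); apply: eq_Rintegral => t _.
    rewrite mulrA; congr (_ * _); move: s0; rewrite /oriented_indic.
    case: (ltP s x); case: (ltP s a); case: (ltP t s); case: (ltP t x);
      case: (ltP t a) => /= *; by [lra | exfalso; lra | rewrite subrr eqxx in s0].
  by move=> <-; rewrite mulr_natl.
(* For x < a the indicator is -1 on [x, a[, and the part of [k] below s integrates to z(x) - z(s)
   instead of z(s); the doubled identity still yields the square. *)
- have -> : \int[mu]_s (k s * \int[mu]_t ((t < s)%R%:R * k t)) =
      z x ^+ 2 - primitive a (fun y => z y * h y) x.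
    rewrite expr2 -{2}[z x]/(\int[mu]_s k s) -RintZ// /primitive -RintB//.
    + apply: eq_Rintegral => s _; rewrite /k.
      have [->|s0] := eqVneq (oriented_indic a x s) 0.
        by rewrite !mul0r !mulr0 subr0.
      rewrite -[X in _ - X]mulrCA -[X in _ - X]mulrC.
      rewrite [z x * _]mulrC -mulrBr; congr (_ * _).
      rewrite /z /primitive -RintB//; [|exact: integrableR_oriented..].
      apply: eq_Rintegral => t _.
      have [xs sa] : x <= s /\ s < a.
        move: s0; rewrite /oriented_indic.
        by case: (ltP s x) => sx; case: (ltP s a) => // sa;
          rewrite ?subrr ?eqxx//; move: (lt_trans sx xa); rewrite ltNge sa.
      rewrite mulrA -mulrBl; congr (_ * _).
      rewrite /oriented_indic.
      case: (ltP t s) => ts; case: (ltP t x) => tx; case: (ltP t a) => ta /=;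
        by [ring | exfalso; lra].
    + exact: integrableRZ.
    + exact: integrableR_oriented.
  move=> e; lra.
Qed.

End primitive.

(** * Monotone functions on half-lines *)

Section ftc_rays.
Context {R : realType}.
Local Notation mu := (@lebesgue_measure R).
Local Notation RT := (measurableTypeR R).
Implicit Types (F f : R -> R).

Lemma Rint_patch (D : set R) f : measurable D -> (forall x, D x -> 0 <= f x) ->
  measurable_fun D f -> forall r : R, (\int[mu]_(x in D) (f x)%:E)%E = r%:E ->
  integrableR (f \_ D) /\ \int[mu]_x (f \_ D) x = r.
Proof.
move=> mD f0 mf r fr; split; last by rewrite -Rintegral_mkcond /Rintegral fr.
have : mu.-integrable D (EFin \o f).
  apply/integrableP; split; first exact/measurable_EFinP.
  rewrite (_ : (\int[mu]_(x in D) _)%E = r%:E) ?ltry// -fr.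
  by apply: eq_integral => x /set_mem Dx /=; rewrite ger0_norm// f0.
by move=> fi; have := (@integrable_mkcond _ RT R mu D (EFin \o f) mD).1 fi; rewrite restrict_EFin.
Qed.

(** Nonnegativity of [f] makes integrability a consequence of the finite limit of [F], by monotone
    convergence; no prior bound on [f] is required. *)
Lemma FTC_ray_right F f (a l : R) :
  (forall x, a <= x -> is_derive x 1 F (f x)) ->
  (forall x, a <= x -> {for x, continuous f}) ->
  (forall x, a <= x -> 0 <= f x) ->
  F x @[x --> +oo] --> l ->
  integrableR (fun x => (a < x)%R%:R * f x) /\
  \int[mu]_x ((a < x)%R%:R * f x) = l - F a.
Proof.
move=> dF cf f0 Fl.
have cfw : {within `[a, +oo[, continuous f}.
  apply: continuous_in_subspaceT => x; rewrite inE/= in_itv/= andbT => ax.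
  exact: cf.
have mf : measurable_fun `]a, +oo[ f.
  apply: open_continuous_measurable_fun => // x.
  by rewrite inE/= in_itv/= andbT => /ltW; exact: cf.
have e : (\int[mu]_(x in `]a, +oo[) (f x)%:E = (l - F a)%:E)%E.
  rewrite integral_itv_obnd_cbnd; last exact/measurable_EFinP.
  rewrite (@ge0_continuous_FTC2y _ f F a l)//.
  - by move=> x /ltW ax; have [] := dF _ ax.
  - apply: cvg_at_right_filter; apply: differentiable_continuous.
    by apply/derivable1_diffP; have [] := dF _ (lexx a).
  - move=> x; rewrite in_itv/= andbT => /ltW ax.
    by rewrite derive1E; have [_ ->] := dF _ ax.
have -> : (fun x => (a < x)%R%:R * f x) = f \_ `]a, +oo[.
  apply/funext => x; rewrite patchE mem_setE in_itv/= andbT.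
  by case: ifP => _; rewrite ?mul1r ?mul0r.
apply: Rint_patch => // x /=; rewrite in_itv/= andbT => /ltW; exact: f0.
Qed.

Lemma FTC_ray_left F f (a l : R) :
  (forall x, x <= a -> is_derive x 1 F (f x)) ->
  (forall x, x <= a -> {for x, continuous f}) ->
  (forall x, x <= a -> 0 <= f x) ->
  F x @[x --> -oo] --> l ->
  integrableR (fun x => (x <= a)%R%:R * f x) /\
  \int[mu]_x ((x <= a)%R%:R * f x) = F a - l.
Proof.
move=> dF cf f0 Fl.
have mf : measurable_fun `]-oo, a] f.
  apply/measurable_fun_itv_bndo_bndcP.
  apply: open_continuous_measurable_fun => // x.
  by rewrite inE/= in_itv/= => /ltW; exact: cf.
(* The reflection x -> -x reduces the left ray to the right one, with antiderivative -F(-x). *)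
have dG x : - a <= x -> is_derive x 1 (fun x => - F (- x)) (f (- x)).
  move=> ax; have dFx : is_derive (- x) 1 F (f (- x)) by apply: dF; rewrite lerNl.
  have := @is_deriveN _ _ _ _ _ _ _ (is_derive1_comp dFx (is_deriveNid x 1)).
  by rewrite mulrN1 opprK.
have e : (\int[mu]_(x in `]-oo, a]) (f x)%:E = (F a - l)%:E)%E.
  rewrite -(opprK a) ge0_integration_by_substitutionNy.
  - rewrite (@ge0_continuous_FTC2y _ (f \o -%R) (fun x => - F (- x)) (- a) (- l))//.
    + by rewrite -EFinB; congr EFin; lra.
    + by move=> x ax; apply: f0; rewrite lerNl.
    + apply: continuous_in_subspaceT => x; rewrite inE/= in_itv/= andbT => ax.
      apply: continuous_comp; first exact: opp_continuous.
      by apply: cf; rewrite lerNl.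
    + by apply: cvgN; have := (cvgNy_compNP F (nbhs l)).1 Fl.
    + by move=> x /ltW ax; have [] := dG _ ax.
    + have cG : {for - a, continuous (fun x => - F (- x))}.
        apply: differentiable_continuous.
        by apply/derivable1_diffP; have [] := dG _ (lexx (- a)).
      exact: (cvg_at_right_filter cG).
    + move=> x; rewrite in_itv/= andbT => /ltW ax.
      by rewrite derive1E; have [_ ->] := dG _ ax.
  - apply: continuous_in_subspaceT => x; rewrite inE/= in_itv/= opprK => xa.
    exact: cf.
  - by move=> x; rewrite in_itv/= opprK => /ltW; exact: f0.
have -> : (fun x => (x <= a)%R%:R * f x) = f \_ `]-oo, a].
  apply/funext => x; rewrite patchE mem_setE in_itv/=.
  by case: ifP => _; rewrite ?mul1r ?mul0r.
by apply: Rint_patch => // x /=; rewrite in_itv/=; exact: f0.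
Qed.

End ftc_rays.

(** * Calibrated Hardy-Poincare inequality *)

Section calibration.
Context {R : realType}.
Local Notation mu := (@lebesgue_measure R).
Local Notation RT := (measurableTypeR R).
Implicit Types (F G p b h d : R -> R).

(** The hypothesis linking [F] and [G] encodes two conditions at once. For y < a the kernel is minus
    the indicator of x <= y, so F(y) is the integral of [G] over ]-oo, y]; for a <= y it is the
    indicator of y < x, so F(y) is minus the integral over ]y, +oo[. *)
Lemma kernel_regular (a : R) F G : integrableR G ->
  (forall y, \int[mu]_x (oriented_indic a x y * G x) = - F y) ->
  measurable_fun setT F /\ forall y, `|F y| <= \int[mu]_x `|G x|.
Proof.
move=> Gi GF.
have -> : F = (fun y => - \int[mu]_x (oriented_indic a x y * G x)).
  by apply/funext => y; rewrite GF opprK.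
have mK : measurable_fun setT (fun q : RT * RT => oriented_indic a q.2 q.1).
  apply: measurable_funB.
    exact: (measurable_indic_lt measurable_fst measurable_snd).
  exact: (measurable_indic_lt measurable_fst (measurable_cst a)).
split.
  apply: measurable_funN.
  by apply: (measurable_kernel mK); exact: integrableR_measurable.
move=> x; rewrite normrN; apply: (kernel_bound x mK _ Gi) => q.
exact: normr_oriented_indic.
Qed.

(** Writing z^2 as the primitive of 2 z h from a and exchanging the integrals lets the kernel act on
    [G], which produces -F. There are no boundary terms: [F] decays at both ends, and its jump at a
    meets z(a) = 0. *)
Lemma sqr_primitive_by_parts (a : R) F G h : integrableR G ->
  (forall y, \int[mu]_x (oriented_indic a x y * G x) = - F y) ->
  integrableR h ->
  \int[mu]_x (G x * primitive a h x ^+ 2) =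
  - \int[mu]_x (2 * F x * primitive a h x * h x).
Proof.
move=> Gi GF hi; have mh := integrableR_measurable hi.
have zhi : integrableR (fun x => 2 * primitive a h x * h x).
  under eq_fun do rewrite -mulrA.
  apply/integrableRZ/(@integrableR_boundedM _ _ (\int[mu]_y `|h y|)) => //.
    exact: measurable_primitive.
  by move=> x; exact: primitive_bound.
under eq_Rintegral do rewrite sqr_primitive//.
rewrite (fubini_kernel (measurable_oriented_indic a) _ Gi zhi); last first.
  by move=> q; exact: normr_oriented_indic.
have cF y : \int[mu]_x (oriented_indic a x y * G x) = - F y by exact: GF.
rewrite -RintN; last first.
  have -> : (fun x => 2 * F x * primitive a h x * h x) =
      (fun x => F x * (2 * primitive a h x * h x)).
    by apply/funext => x; ring.
  have [mF FM] := kernel_regular Gi GF.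
  exact: (integrableR_boundedM mF FM).
by apply: eq_Rintegral => y _; rewrite cF; ring.
Qed.

(* F is an antiderivative of G on each side of a, vanishing at both infinities but
   possibly jumping at a; the square completed is p (h + F z / p)^2. *)
Lemma calibration_le (a : R) F G p b h :
  integrableR G ->
  (forall y, \int[mu]_x (oriented_indic a x y * G x) = - F y) ->
  (forall x, 0 < p x) ->
  (forall x, b x + F x ^+ 2 / p x <= G x) ->
  integrableR h -> integrableR (fun x => p x * h x ^+ 2) -> integrableR b ->
  \int[mu]_x (b x * primitive a h x ^+ 2) <= \int[mu]_x (p x * h x ^+ 2).
Proof.
move=> Gi GF p0 bG hi phi bi; have [mF FM] := kernel_regular Gi GF; set z := primitive a h.
have mh := integrableR_measurable hi.
have mz : measurable_fun setT z by exact: measurable_primitive.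
have zC x : `|z x| <= \int[mu]_y `|h y| by exact: primitive_bound.
set C := \int[mu]_y `|h y| in zC.
have C0 : 0 <= C by apply: Rintegral_ge0.
have z2i f : integrableR f -> integrableR (fun x => f x * z x ^+ 2).
  move=> fi; under eq_fun do rewrite mulrC.
  apply: (@integrableR_boundedM _ _ (C ^+ 2)) => //.
    exact: measurable_funX.
  by move=> x; rewrite normrX lerXn2r ?nnegrE.
have Fzhi : integrableR (fun x => 2 * F x * z x * h x).
  apply: (@integrableR_boundedM _ _ (2 * \int[mu]_x `|G x| * C)) => //.
    by apply: measurable_funM => //; apply: measurable_funM.
  move=> x; rewrite !normrM ger0_norm// ler_pM// ?mulr_ge0// ler_wpM2l//.
have := sqr_primitive_by_parts Gi GF hi; rewrite -/z => ibp.
(* The added bracket is the exact derivative of F z^2, whose integral is zero by [ibp]. *)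
have -> : \int[mu]_x (p x * h x ^+ 2) =
    \int[mu]_x (p x * h x ^+ 2 + (2 * F x * z x * h x + G x * z x ^+ 2)).
  by rewrite RintD ?RintD ?ibp ?subrr ?addr0//; [exact: z2i|apply: integrableRD => //; exact: z2i].
apply: Rint_le.
- exact: z2i.
- by apply: integrableRD => //; apply: integrableRD => //; exact: z2i.
move=> x; have p0x := p0 x.
have -> : p x * h x ^+ 2 + (2 * F x * z x * h x + G x * z x ^+ 2) =
    (p x * h x + F x * z x) ^+ 2 / p x + (G x - F x ^+ 2 / p x) * z x ^+ 2.
  by field; rewrite gt_eqF.
apply: (@le_trans _ _ ((G x - F x ^+ 2 / p x) * z x ^+ 2)).
  by rewrite ler_wpM2r ?sqr_ge0// lerBrDr.
by rewrite lerDr divr_ge0 ?sqr_ge0// ltW.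
Qed.

Definition cutoff (M x : R) : R := (`|x| <= M)%R%:R.

Lemma cutoff_indic (M : R) : cutoff M = \1_`[- M, M].
Proof.
apply/funext => x; rewrite indicE /cutoff; congr (nat_of_bool _)%:R.
by rewrite mem_setE in_itv/= ler_norml.
Qed.

Lemma measurable_cutoff (M : R) : measurable_fun setT (cutoff M).
Proof. by rewrite cutoff_indic; exact: measurable_indic. Qed.

Lemma integrableR_cutoff (M : R) : integrableR (cutoff M).
Proof. by rewrite cutoff_indic; exact: integrable_indic_itv. Qed.

Lemma normr_cutoff (M x : R) : `|cutoff M x| <= 1.
Proof. by rewrite /cutoff; case: (`|x| <= M)%R; rewrite ?normr1 ?normr0 ?lexx ?ler01. Qed.

Lemma integrableR_cutoff_sqr (M : R) d : measurable_fun setT d ->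
  integrableR (fun x => d x ^+ 2) -> integrableR (fun x => cutoff M x * d x).
Proof.
move=> md di; apply: (@integrableR_le _ _ (fun x => cutoff M x + d x ^+ 2)).
- by apply: measurable_funM => //; exact: measurable_cutoff.
- move=> x; have hd : `|d x| <= 1 + d x ^+ 2.
    by rewrite -(real_normK (num_real (d x))); have := normr_ge0 (d x); nra.
  by rewrite /cutoff; case: (`|x| <= M)%R; rewrite ?mul1r// mul0r normr0 add0r sqr_ge0.
- by apply: integrableRD => //; exact: integrableR_cutoff.
Qed.

Lemma cvg_cutoff (x r : R) : cutoff n%:R x * r @[n --> \oo] --> r.
Proof.
apply: cvg_near_cst; near=> n; rewrite /cutoff.
have -> : (`|x| <= n%:R)%R by near: n; exact: nbhs_infty_ger.
by rewrite mul1r.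
Unshelve. all: by end_near. Qed.

Lemma primitive_cutoff (a x M : R) d : `|a| <= M -> `|x| <= M ->
  primitive a (fun y => cutoff M y * d y) x = primitive a d x.
Proof.
move=> aM xM; apply: eq_Rintegral => y _; rewrite mulrA; congr (_ * _).
rewrite /cutoff /oriented_indic; move: aM xM; rewrite !ler_norml.
move=> /andP[? ?] /andP[? ?].
case: (ltP y x); case: (ltP y a); case: (lerP (- M) y); case: (lerP y M) => /= *;
  by [lra | exfalso; lra].
Qed.

Lemma calibration_le_L2 (a : R) F G p b d :
  integrableR G ->
  (forall y, \int[mu]_x (oriented_indic a x y * G x) = - F y) ->
  (forall x, 0 < p x) -> measurable_fun setT p ->
  (forall x, b x + F x ^+ 2 / p x <= G x) -> (forall x, 0 <= b x) ->
  measurable_fun setT d -> integrableR (fun x => d x ^+ 2) ->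
  integrableR (fun x => p x * d x ^+ 2) -> integrableR b ->
  integrableR (fun x => b x * primitive a d x ^+ 2) ->
  \int[mu]_x (b x * primitive a d x ^+ 2) <= \int[mu]_x (p x * d x ^+ 2).
Proof.
move=> Gi GF p0 mp bG b0 md di pdi bi bzi.
pose dn n y := cutoff n%:R y * d y.
have dn2 n y : dn n y ^+ 2 = cutoff n%:R y * d y ^+ 2.
  rewrite /dn exprMn; congr (_ * _); rewrite /cutoff.
  by case: (`|y| <= n%:R)%R; rewrite ?expr1n ?expr0n.
have step n : `|a| <= n%:R ->
    \int[mu]_x (cutoff n%:R x * (b x * primitive a d x ^+ 2)) <=
    \int[mu]_x (p x * d x ^+ 2).
  move=> an.
  have dni : integrableR (dn n) by exact: integrableR_cutoff_sqr.
  have pdni : integrableR (fun x => p x * dn n x ^+ 2).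
    under eq_fun do rewrite dn2 mulrCA.
    apply: (@integrableR_boundedM _ _ 1) => //; first exact: measurable_cutoff.
    by move=> x; exact: normr_cutoff.
  apply: (@le_trans _ _ (\int[mu]_x (p x * dn n x ^+ 2))); last first.
    apply: Rint_le => // x; rewrite dn2 ler_wpM2l//; first exact: ltW.
    by rewrite /cutoff; case: (`|x| <= n%:R)%R; rewrite ?mul1r ?mul0r ?sqr_ge0.
  apply: le_trans (calibration_le Gi GF p0 bG dni pdni bi).
  apply: Rint_le.
  - apply: (@integrableR_boundedM _ _ 1) => //; first exact: measurable_cutoff.
    by move=> x; exact: normr_cutoff.
  - under eq_fun do rewrite mulrC.
    apply: (@integrableR_boundedM _ _ ((\int[mu]_y `|dn n y|) ^+ 2)) => //.
      by apply: measurable_funX; apply: measurable_primitive; exact: integrableR_measurable.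
    by move=> x; rewrite normrX lerXn2r ?nnegrE ?Rintegral_ge0//; exact: primitive_bound.
  - move=> x; rewrite /cutoff; case: (leP `|x| n%:R) => xn.
      by rewrite mul1r primitive_cutoff.
    by rewrite mul0r mulr_ge0 ?sqr_ge0.
apply: (@ler_cvg_to _ \oo _ _
  (fun n => \int[mu]_x (cutoff n%:R x * (b x * primitive a d x ^+ 2)))
  (fun=> \int[mu]_x (p x * d x ^+ 2))).
- apply: Rint_dominated_cvg (bzi) _ => //.
  + move=> n; apply: measurable_funM; first exact: measurable_cutoff.
    exact: integrableR_measurable.
  + exact: integrableR_measurable.
  + by move=> x; exact: cvg_cutoff.
  + move=> n x; have bz0 := mulr_ge0 (b0 x) (sqr_ge0 (primitive a d x)).
    by rewrite normrM [X in _ * X]ger0_norm//; apply: ler_piMl => //; exact: normr_cutoff.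
- exact: cvg_cst.
- near=> n; apply: step; near: n; exact: nbhs_infty_ger.
Unshelve. all: by end_near. Qed.

End calibration.

(** * Scalar inequalities *)

Section riccati.
Context {R : realFieldType}.
Implicit Types s : R.

(* N = (1 - s) (34 - s) / 3 is the least weight with P + N w^2 >= 0, since
   N = (5 + s)^2 / 3 - (15 s - 3). The term (16 - s)^2 / 108 is what the cross terms in m
   cost, and 2/25 is the room left for coercivity. *)
Definition mixing_weight s : R := (1 - s) * (34 - s) / 3 + (16 - s) ^+ 2 / 108 + 2 / 25.

(* Rational approximations of the solutions of the Riccati equation
   g' = g^2 / ((5 - s) (s + 2) (1 - s)^2) + mixing_weight that vanish at -2, respectively
   at 1. The true solutions blow up slightly to the right, respectively to the left, of
   -4/5, which is why the poles -39/50 and -41/50 lie where they do. *)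
Definition calibL s : R := - ((s + 2) * (1 - s) * (11 / 2 * (1 - s))) / (s + 39 / 50).
Definition dcalibL s : R :=
  - ((- (1 + 2 * s) * (11 / 2 * (1 - s)) - (s + 2) * (1 - s) * (11 / 2)) * (s + 39 / 50)
     - (s + 2) * (1 - s) * (11 / 2 * (1 - s))) / (s + 39 / 50) ^+ 2.

Definition calibR s : R := - ((s + 2) * (1 - s) * ((25 - 18 * s) / 4)) / (s + 41 / 50).
Definition dcalibR s : R :=
  - ((- (1 + 2 * s) * ((25 - 18 * s) / 4) - (s + 2) * (1 - s) * (9 / 2)) * (s + 41 / 50)
     - (s + 2) * (1 - s) * ((25 - 18 * s) / 4)) / (s + 41 / 50) ^+ 2.

(* The two quintics below have nonnegative coefficients in the Bernstein basis of
   [-2, -4/5], respectively in those of [-4/5, 0] and [0, 1]. *)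
Lemma riccati_quintic_left s : - 2 <= s <= - (4 / 5) ->
  0 <= (5 - s) * ((s + 2) * (1 - s) * (11 / 2 * (1 - s))
        - (s + 39 / 50) * (- (1 + 2 * s) * (11 / 2 * (1 - s)) - (s + 2) * (1 - s) * (11 / 2)))
     - (s + 2) * (11 / 2 * (1 - s)) ^+ 2
     - (s + 39 / 50) ^+ 2 * (5 - s) * mixing_weight s.
Proof.
move=> /andP[s1 s2]; rewrite /mixing_weight.
have a0 : 0 <= s + 2 by lra.
have b0 : 0 <= - (4 / 5) - s by lra.
have p i j : 0 <= (s + 2) ^+ i * (- (4 / 5) - s) ^+ j by rewrite mulr_ge0 ?exprn_ge0.
have := (p 0 5, p 1 4, p 2 3, p 3 2, p 4 1, p 5 0)%N => -[[[[[]]]]].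
lra.
Qed.

Lemma riccati_quintic_right s : - (4 / 5) <= s <= 1 ->
  0 <= (5 - s) * ((s + 2) * (1 - s) * ((25 - 18 * s) / 4)
        - (s + 41 / 50) * (- (1 + 2 * s) * ((25 - 18 * s) / 4) - (s + 2) * (1 - s) * (9 / 2)))
     - (s + 2) * ((25 - 18 * s) / 4) ^+ 2
     - (s + 41 / 50) ^+ 2 * (5 - s) * mixing_weight s.
Proof.
move=> /andP[s1 s2]; rewrite /mixing_weight.
have [s0|s0] := leP s 0.
- have a0 : 0 <= s + 4 / 5 by lra.
  have b0 : 0 <= - s by lra.
  have p i j : 0 <= (s + 4 / 5) ^+ i * (- s) ^+ j by rewrite mulr_ge0 ?exprn_ge0.
  have := (p 0 5, p 1 4, p 2 3, p 3 2, p 4 1, p 5 0)%N => -[[[[[]]]]].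
  lra.
- have b0 : 0 <= 1 - s by lra.
  have p i j : 0 <= s ^+ i * (1 - s) ^+ j by rewrite mulr_ge0 ?exprn_ge0// ltW.
  have := (p 0 5, p 1 4, p 2 3, p 3 2, p 4 1, p 5 0)%N => -[[[[[]]]]].
  lra.
Qed.

(** The factor (s + 2)(1 - s) of [calibL], squared, cancels the degeneracy of A at both end states,
    so after clearing (5 - s)(s + 39/50)^2 the difference of the two sides is (s + 2)(1 - s)^2 times
    the quintic already shown nonnegative. *)
Lemma riccati_left s : - 2 < s <= - (4 / 5) ->
  mixing_weight s * ((s + 2) * (1 - s) ^+ 2) + calibL s ^+ 2 / (5 - s) <=
  dcalibL s * ((s + 2) * (1 - s) ^+ 2).
Proof.
move=> /andP[s1 s2]; have := @riccati_quintic_left s.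
rewrite s2 ltW//= => /(_ isT) q; rewrite -subr_ge0.
have d0 : s + 39 / 50 != 0 by rewrite lt_eqF//; lra.
have f0 : 5 - s != 0 by rewrite gt_eqF//; lra.
set Q := (X in 0 <= X) in q.
have -> : dcalibL s * ((s + 2) * (1 - s) ^+ 2) -
    (mixing_weight s * ((s + 2) * (1 - s) ^+ 2) + calibL s ^+ 2 / (5 - s)) =
    Q * (((s + 2) * (1 - s) ^+ 2) / ((5 - s) * (s + 39 / 50) ^+ 2)).
  rewrite /Q /dcalibL /calibL; field; rewrite f0 andbT lt_eqF//; lra.
rewrite mulr_ge0// divr_ge0// mulr_ge0 ?sqr_ge0//; lra.
Qed.

Lemma riccati_right s : - (4 / 5) <= s < 1 ->
  mixing_weight s * ((s + 2) * (1 - s) ^+ 2) + calibR s ^+ 2 / (5 - s) <=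
  dcalibR s * ((s + 2) * (1 - s) ^+ 2).
Proof.
move=> /andP[s1 s2]; have := @riccati_quintic_right s.
rewrite s1 ltW//= => /(_ isT) q; rewrite -subr_ge0.
have d0 : s + 41 / 50 != 0 by rewrite gt_eqF//; lra.
have f0 : 5 - s != 0 by rewrite gt_eqF//; lra.
set Q := (X in 0 <= X) in q.
have -> : dcalibR s * ((s + 2) * (1 - s) ^+ 2) -
    (mixing_weight s * ((s + 2) * (1 - s) ^+ 2) + calibR s ^+ 2 / (5 - s)) =
    Q * (((s + 2) * (1 - s) ^+ 2) / ((5 - s) * (s + 41 / 50) ^+ 2)).
  rewrite /Q /dcalibR /calibR; field; rewrite f0 andbT gt_eqF//; lra.
rewrite mulr_ge0// divr_ge0// mulr_ge0 ?sqr_ge0//; lra.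
Qed.

(** The coefficient of m^2 left after both squares are completed: the first summand is what remains
    for w = m, and 12 (s + 1)^2 is the price of the cross term in z m. *)
Definition mean_density s : R := (41 - 5 * s - s ^+ 2) / 3 - 12 * (s + 1) ^+ 2.

(** The first square absorbs the quartic and cubic terms and 5 m w^2. In the remaining quadratic
    form in (z, m), z = w - m, the cross coefficient factors as 2 (16 - s)(s + 1)/3, which the
    second square absorbs. Only 1/25 of the room 2/25 in [mixing_weight] is used here; the other
    half is kept for the gradient. *)
Lemma potential_sos (s w m : R) :
  (15 * s - 3) * w ^+ 2 + (5 + s) * w ^+ 3 + 3 / 4 * w ^+ 4
  + 10 * m * ((5 - s) * w + w ^+ 2 / 2)
  + (mixing_weight s - 1 / 25) * (w - m) ^+ 2
  = 3 / 4 * (w ^+ 2 + 2 / 3 * ((5 + s) * w + 5 * m)) ^+ 2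
  + ((16 - s) * (w - m) + 36 * (s + 1) * m) ^+ 2 / 108
  + (w - m) ^+ 2 / 25 + mean_density s * m ^+ 2.
Proof. by rewrite /mixing_weight /mean_density; field. Qed.

End riccati.

(** * Derivatives of the calibrations *)

Section derivatives.
Context {R : realType}.
Implicit Types f g : R -> R.

Lemma is_derive_add f g (x df dg : R) : is_derive x 1 f df -> is_derive x 1 g dg ->
  is_derive x 1 (fun y => f y + g y) (df + dg).
Proof. by move=> fx gx; exact: is_deriveD. Qed.

Lemma is_derive_opp f (x df : R) : is_derive x 1 f df ->
  is_derive x 1 (fun y => - f y) (- df).
Proof. by move=> fx; exact: is_deriveN. Qed.

Lemma is_derive_mul f g (x df dg : R) : is_derive x 1 f df -> is_derive x 1 g dg ->
  is_derive x 1 (fun y => f y * g y) (df * g x + f x * dg).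
Proof.
move=> fx gx; apply: (is_derive_eq (is_deriveM fx gx)).
by rewrite addrC /GRing.scale/= mulrC.
Qed.

Lemma is_derive_div f g (x df dg : R) : g x != 0 ->
  is_derive x 1 f df -> is_derive x 1 g dg ->
  is_derive x 1 (fun y => f y / g y) ((df * g x - f x * dg) / g x ^+ 2).
Proof.
move=> g0 fx gx; apply: (is_derive_eq (is_derive_mul fx (is_deriveV g0 gx))).
by rewrite /GRing.scale/=; field.
Qed.

Lemma is_derive_comp f g (x df dg : R) :
  is_derive (g x) 1 f df -> is_derive x 1 g dg ->
  is_derive x 1 (fun y => f (g y)) (df * dg).
Proof. by move=> fx gx; exact: is_derive1_comp. Qed.

Lemma is_derive_continuous f (x df : R) : is_derive x 1 f df -> {for x, continuous f}.
Proof.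
by move=> fx; apply: differentiable_continuous; apply/derivable1_diffP; case: fx.
Qed.

Lemma is_derive_affine (a b x : R) : is_derive x 1 (fun y => a * y + b) a.
Proof.
have := is_derive_add (is_derive_mul (is_derive_cst a x 1) (is_derive_id x 1))
  (is_derive_cst b x 1).
by rewrite mul0r add0r mulr1 addr0.
Qed.

End derivatives.

Section calib_derivatives.
Context {R : realType}.
Implicit Types s : R.

Let is_derive_G s : is_derive s 1 (fun s => (s + 2) * (1 - s)) (- (1 + 2 * s)).
Proof.
have dl : is_derive s 1 (fun s => s + 2) 1.
  by have := is_derive_affine 1 2 s; under eq_fun do rewrite mul1r.
have dr : is_derive s 1 (fun s => 1 - s) (-1).
  by have := is_derive_affine (-1) 1 s; under eq_fun do rewrite mulN1r addrC.
by apply: (is_derive_eq (is_derive_mul dl dr)); ring.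
Qed.

Let is_derive_shift (c s : R) : is_derive s 1 (fun s => s + c) 1.
Proof. by have := is_derive_affine 1 c s; under eq_fun do rewrite mul1r. Qed.

Lemma is_derive_calibL s : s + 39 / 50 != 0 -> is_derive s 1 calibL (dcalibL s).
Proof.
move=> s0.
have dn : is_derive s 1 (fun s => 11 / 2 * (1 - s)) (- (11 / 2)).
  have := is_derive_affine (- (11 / 2)) (11 / 2) s.
  by under eq_fun do rewrite mulNr addrC -{1}[11 / 2]mulr1 -mulrBr.
have := is_derive_div (g := fun s => s + 39 / 50) s0
  (is_derive_opp (is_derive_mul (is_derive_G s) dn)) (is_derive_shift _ s).
by move=> h; apply: (is_derive_eq h); rewrite /dcalibL; congr (_ / _); ring.
Qed.

Lemma is_derive_calibR s : s + 41 / 50 != 0 -> is_derive s 1 calibR (dcalibR s).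
Proof.
move=> s0.
have dn : is_derive s 1 (fun s => (25 - 18 * s) / 4) (- (9 / 2)).
  have := is_derive_affine (- (9 / 2)) (25 / 4) s.
  rewrite (_ : (fun y => _) = (fun s => (25 - 18 * s) / 4))//.
  by apply/funext => y; field.
have := is_derive_div (g := fun s => s + 41 / 50) s0
  (is_derive_opp (is_derive_mul (is_derive_G s) dn)) (is_derive_shift _ s).
by move=> h; apply: (is_derive_eq h); rewrite /dcalibR; congr (_ / _); ring.
Qed.

Lemma is_derive_poly3 (a b c e s : R) :
  is_derive s 1 (fun s => a * s ^+ 3 + b * s ^+ 2 + c * s + e)
    (3 * a * s ^+ 2 + 2 * b * s + c).
Proof.
have d1 := is_derive_affine 1 0 s.
have d2 := is_derive_mul d1 d1; have d3 := is_derive_mul d1 d2.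
have dc (r : R) := @is_derive_cst R R R r s 1.
have := is_derive_add (is_derive_mul (dc a) d3) (is_derive_add (is_derive_mul (dc b) d2)
   (is_derive_affine c e s)).
rewrite (_ : (fun y => _) = (fun s => a * s ^+ 3 + b * s ^+ 2 + c * s + e)).
  by move=> h; apply: (is_derive_eq h); rewrite /cst; ring.
by apply/funext => y; rewrite /cst; ring.
Qed.

End calib_derivatives.

(** * The shock profile *)

Section profile.
Context {R : realType} (k : R) (u : R -> R).
Hypotheses (k0 : 0 < k) (ub : forall x, - 2 < u x < 1)
  (du : forall x : R, is_derive x (1 : R) u (k * ((u x + 2) * (1 - u x) ^+ 2)))
  (uNy : u x @[x --> -oo] --> (- 2 : R)) (uy : u x @[x --> +oo] --> (1 : R)).
Local Notation mu := (@lebesgue_measure R).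

Definition speed (x : R) : R := k * ((u x + 2) * (1 - u x) ^+ 2).

Lemma profile_continuous : continuous u.
Proof. by move=> x; exact: is_derive_continuous (du x). Qed.

Lemma speed_gt0 x : 0 < speed x.
Proof.
have /andP[u1 u2] := ub x.
by rewrite /speed mulr_gt0// mulr_gt0 ?exprn_gt0//; lra.
Qed.

Lemma continuous_comp_profile (g : R -> R) x : {for u x, continuous g} ->
  {for x, continuous (fun y => g (u y))}.
Proof.
move=> cg; apply: (@cvg_comp _ _ _ u g _ (nbhs (u x)) _ _ cg).
exact: profile_continuous.
Qed.

Lemma speed_continuous : continuous speed.
Proof.
move=> x; have d2 := is_derive_add (du x) (is_derive_cst (2 : R) x 1).
have d1 := is_derive_add (is_derive_cst (1 : R) x 1) (is_derive_opp (du x)).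
exact: is_derive_continuous (is_derive_mul (is_derive_cst k x 1)
  (is_derive_mul d2 (is_derive_mul d1 d1))).
Qed.

Lemma profile_increasing : {homo u : x y / x < y}.
Proof.
move=> x y xy; apply: (@gtr0_derive1_lt_cc R u x y) => //.
- by move=> z _; rewrite derive1E; have [_ ->] := du z; exact: speed_gt0.
- by apply: continuous_subspaceT => z; exact: profile_continuous.
- by rewrite in_itv/= lexx ltW.
- by rewrite in_itv/= lexx ltW.
Qed.

Lemma profile_attains (s : R) : - 2 < s < 1 -> exists x, u x = s.
Proof.
move=> /andP[s1 s2].
have [a ua] := filter_ex (cvgr_lt _ uNy s s1).
have [b sub] := filter_ex (cvgr_gt _ uy s s2).
have ab : a <= b.
  rewrite leNgt; apply/negP => /profile_increasing.
  by rewrite ltNge => /negP; apply; rewrite ltW// (lt_trans ua).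
have [||x _ <-] := @IVT R u a b s ab; last by exists x.
- by apply: continuous_subspaceT => z; exact: profile_continuous.
- by rewrite min_l ?max_r ?ltW// (lt_trans ua).
Qed.

(** The change of variables s = u(x), ds = [speed] dx, onto ]-2, 1[, obtained from the two rays
    meeting at 0. Taking t = 1 gives total mass 3. *)
Lemma Rint_speed (T t : R -> R) :
  (forall s : R, is_derive s (1 : R) T (t s)) -> continuous t ->
  (forall s : R, - 2 < s < 1 -> 0 <= t s) ->
  integrableR (fun x => speed x * t (u x)) /\
  \int[mu]_x (speed x * t (u x)) = T 1 - T (- 2).
Proof.
move=> dT ct t0.
pose f x := speed x * t (u x).
have dF (x : R) : is_derive x (1 : R) (fun y => T (u y)) (f x).
  by apply: (is_derive_eq (is_derive_comp (dT (u x)) (du x))); rewrite mulrC.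
have cf x : {for x, continuous f}.
  apply: continuousM; first exact: speed_continuous.
  by apply: continuous_comp_profile; exact: ct.
have f0 x : 0 <= f x by rewrite mulr_ge0// ?t0// ltW// speed_gt0.
have cT s : {for s, continuous T} by exact: is_derive_continuous (dT s).
have [i1 r1] := FTC_ray_right (a := 0) (fun x _ => dF x) (fun x _ => cf x)
  (fun x _ => f0 x) (cvg_comp _ _ uy (cT 1)).
have [i2 r2] := FTC_ray_left (a := 0) (fun x _ => dF x) (fun x _ => cf x)
  (fun x _ => f0 x) (cvg_comp _ _ uNy (cT (-2))).
have e : f = fun x => (0 < x)%R%:R * f x + (x <= 0)%R%:R * f x.
  by apply/funext => x; case: ltP => _; rewrite ?mul1r ?mul0r ?addr0 ?add0r.
split; first by rewrite -/f e; exact: integrableRD.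
by rewrite -/f e RintD// r1 r2; ring.
Qed.

Lemma integrableR_speed : integrableR speed.
Proof.
have [] := @Rint_speed id (cst 1).
- by move=> s; exact: cvg_cst.
- by move=> s _; rewrite /cst ler01.
by move=> + _; under eq_fun do rewrite mulr1.
Qed.

Lemma integrableR_speedM (f : R -> R) (M : R) : measurable_fun setT f ->
  (forall x, `|f x| <= M) -> integrableR (fun x => speed x * f x).
Proof.
move=> mf fM; under eq_fun do rewrite mulrC.
by apply: (integrableR_boundedM mf fM); exact: integrableR_speed.
Qed.

Lemma Rint_mean_density :
  integrableR (fun x => speed x * mean_density (u x)) /\
  \int[mu]_x (speed x * mean_density (u x)) = 13 / 2.
Proof.
have [||i1 r1] := @Rint_speed id (cst 1).
- by move=> s; exact: cvg_cst.
- by move=> s _; rewrite /cst ler01.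
(* [mean_density] changes sign while [Rint_speed] requires a nonnegative density; adding 50 repairs
   this, and 50 times the mass 3 is subtracted at the end. [T] is the antiderivative of the shifted
   density. *)
pose T (s : R) : R := - (37 / 9) * s ^+ 3 + - (77 / 6) * s ^+ 2 + (155 / 3) * s + 0.
have [|||i2 r2] := @Rint_speed T (fun s => mean_density s + 50).
- move=> s; apply: (is_derive_eq (is_derive_poly3 _ _ _ _ _)).
  by rewrite /mean_density; field.
- move=> s; apply: (@is_derive_continuous _ _ _ (- (74 / 3) * s + - (77 / 3))).
  have := is_derive_poly3 0 (- (37 / 3)) (- (77 / 3)) (155 / 3) s.
  rewrite (_ : (fun y => _) = (fun s => mean_density s + 50)).
    by move=> h; apply: (is_derive_eq h); ring.
  by apply/funext => y; rewrite /mean_density; field.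
- by move=> s /andP[s1 s2]; rewrite /mean_density; nra.
have e x : speed x * mean_density (u x) =
    speed x * (mean_density (u x) + 50) - 50 * (speed x * cst 1 (u x)).
  by rewrite /cst; ring.
split; first by under eq_fun do rewrite e; apply: integrableRB => //; exact: integrableRZ.
under eq_Rintegral do rewrite e.
rewrite RintB//; last exact: integrableRZ.
by rewrite RintZ// r1 r2 /T; field.
Qed.

Lemma measurable_continuous_profile (f : R -> R) : continuous f ->
  measurable_fun setT (fun x => f (u x)).
Proof.
move=> cf; apply: continuous_measurable_fun => x.
by apply: continuous_comp_profile; exact: cf.
Qed.

Lemma measurable_affine_profile (a b : R) : measurable_fun setT (fun x => a * u x + b).
Proof.
apply: (@measurable_continuous_profile (fun s => a * s + b)) => s.
exact: is_derive_continuous (is_derive_affine a b s).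
Qed.

Lemma mixing_weight_profile x : 0 <= mixing_weight (u x) <= 50.
Proof.
by have /andP[u1 u2] := ub x; rewrite /mixing_weight; apply/andP; split; nra.
Qed.

Lemma measurable_mixing_weight : measurable_fun setT (fun x => mixing_weight (u x)).
Proof.
apply: measurable_continuous_profile => s.
apply: (@is_derive_continuous _ _ _ (- (35 / 3) + 2 / 3 * s - (16 - s) / 54)).
have := is_derive_poly3 0 (37 / 108) (- (35 / 3) - 8 / 27) (34 / 3 + 256 / 108 + 2 / 25) s.
rewrite (_ : (fun y => _) = mixing_weight).
  by move=> h; apply: (is_derive_eq h); field.
by apply/funext => y; rewrite /mixing_weight; field.
Qed.

Section split.
Variable a : R.
Hypothesis ua : u a = - (4 / 5).

Let gL x := dcalibL (u x) * speed x.
Let gR x := dcalibR (u x) * speed x.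
Let F x := if (x < a)%R then calibL (u x) else calibR (u x).
Let G x := if (x < a)%R then gL x else gR x.

Let uleft x : x <= a -> - 2 < u x <= - (4 / 5).
Proof.
have /andP[-> _] /= := ub x.
by rewrite -ua le_eqVlt => /predU1P[->|/profile_increasing/ltW].
Qed.

Let uright x : a <= x -> - (4 / 5) <= u x < 1.
Proof.
have /andP[_ ->] /= := ub x; rewrite andbT.
by rewrite -ua le_eqVlt => /predU1P[->|/profile_increasing/ltW].
Qed.

Let continuous_rational (P Q : R -> R) (s dP dQ : R) : Q s != 0 ->
  is_derive s (1 : R) P dP -> is_derive s (1 : R) Q dQ ->
  {for s, continuous (fun y => P y / Q y ^+ 2)}.
Proof.
move=> Q0 Pd Qd.
apply: (is_derive_continuous (is_derive_div (g := fun y => Q y ^+ 2) _ Pd _)).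
  by rewrite expf_neq0.
Qed.

Let continuous_dcalibL (s : R) : s + 39 / 50 != 0 -> {for s, continuous dcalibL}.
Proof.
move=> s0.
(* The cubic is the expanded numerator of [dcalibL], whose linear term cancels. *)
have dP := is_derive_poly3 (- 11) (- (1287 / 100)) 0 (2387 / 100) s.
have dQ : is_derive s (1 : R) (fun s => s + 39 / 50) 1.
  by have := is_derive_affine 1 (39 / 50) s; under eq_fun do rewrite mul1r.
have := continuous_rational (Q := fun s => s + 39 / 50) s0 dP dQ.
rewrite (_ : (fun y => _) = dcalibL)//.
by apply/funext => y; rewrite /dcalibL; congr (_ / _); field.
Qed.

Let continuous_dcalibR (s : R) : s + 41 / 50 != 0 -> {for s, continuous dcalibR}.
Proof.
move=> s0.
have dP := is_derive_poly3 (- 9) (- (233 / 25)) (287 / 100) (5001 / 200) s.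
have dQ : is_derive s (1 : R) (fun s => s + 41 / 50) 1.
  by have := is_derive_affine 1 (41 / 50) s; under eq_fun do rewrite mul1r.
have := continuous_rational (Q := fun s => s + 41 / 50) s0 dP dQ.
rewrite (_ : (fun y => _) = dcalibR)//.
by apply/funext => y; rewrite /dcalibR; congr (_ / _); field.
Qed.

Let riccatiL x : x <= a ->
  speed x * mixing_weight (u x) + calibL (u x) ^+ 2 / ((5 - u x) / k) <= gL x.
Proof.
move=> /uleft h; have /andP[u1 u2] := h.
have -> : speed x * mixing_weight (u x) + calibL (u x) ^+ 2 / ((5 - u x) / k) =
    k * (mixing_weight (u x) * ((u x + 2) * (1 - u x) ^+ 2)
         + calibL (u x) ^+ 2 / (5 - u x)).
  by rewrite /speed; field; rewrite !gt_eqF//; lra.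
have -> : gL x = k * (dcalibL (u x) * ((u x + 2) * (1 - u x) ^+ 2)).
  by rewrite /gL /speed; ring.
by rewrite ler_pM2l//; exact: riccati_left.
Qed.

Let riccatiR x : a <= x ->
  speed x * mixing_weight (u x) + calibR (u x) ^+ 2 / ((5 - u x) / k) <= gR x.
Proof.
move=> /uright h; have /andP[u1 u2] := h.
have -> : speed x * mixing_weight (u x) + calibR (u x) ^+ 2 / ((5 - u x) / k) =
    k * (mixing_weight (u x) * ((u x + 2) * (1 - u x) ^+ 2)
         + calibR (u x) ^+ 2 / (5 - u x)).
  by rewrite /speed; field; rewrite !gt_eqF//; lra.
have -> : gR x = k * (dcalibR (u x) * ((u x + 2) * (1 - u x) ^+ 2)).
  by rewrite /gR /speed; ring.
by rewrite ler_pM2l//; exact: riccati_right.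
Qed.

Let gL_ge0 x : x <= a -> 0 <= gL x.
Proof.
move=> xa; apply: le_trans (riccatiL xa).
have /andP[m0 _] := mixing_weight_profile x; have /andP[_ u2] := ub x.
apply: addr_ge0; first by rewrite mulr_ge0// ltW// speed_gt0.
by apply: divr_ge0; rewrite ?sqr_ge0// divr_ge0 ?(ltW k0)//; lra.
Qed.

Let gR_ge0 x : a <= x -> 0 <= gR x.
Proof.
move=> xa; apply: le_trans (riccatiR xa).
have /andP[m0 _] := mixing_weight_profile x; have /andP[_ u2] := ub x.
apply: addr_ge0; first by rewrite mulr_ge0// ltW// speed_gt0.
by apply: divr_ge0; rewrite ?sqr_ge0// divr_ge0 ?(ltW k0)//; lra.
Qed.

Let calibL_ray y : y <= a -> integrableR (fun x => (x <= y)%R%:R * gL x) /\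
  \int[mu]_x ((x <= y)%R%:R * gL x) = calibL (u y).
Proof.
move=> ya; have nz x : x <= y -> u x + 39 / 50 != 0.
  by move=> xy; have /andP[u1 u2] := uleft (le_trans xy ya); rewrite lt_eqF//; lra.
rewrite -[calibL (u y)]subr0; apply: (@FTC_ray_left _ (fun x => calibL (u x)) gL).
- by move=> x xy; apply: is_derive_comp (du x); exact/is_derive_calibL/nz.
- move=> x xy; apply: continuousM; last exact: speed_continuous.
  by apply: continuous_comp_profile; apply: continuous_dcalibL; exact: nz.
- by move=> x xy; apply: gL_ge0; exact: le_trans ya.
- rewrite (_ : 0 = calibL (- 2)); last by rewrite /calibL addNr !mul0r oppr0 mul0r.
  apply: (cvg_comp _ _ uNy); apply: (is_derive_continuous (is_derive_calibL _)).
  by rewrite lt_eqF//; lra.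
Qed.

Let calibR_ray y : a <= y -> integrableR (fun x => (y < x)%R%:R * gR x) /\
  \int[mu]_x ((y < x)%R%:R * gR x) = - calibR (u y).
Proof.
move=> ya; have nz x : y <= x -> u x + 41 / 50 != 0.
  by move=> xy; have /andP[u1 u2] := uright (le_trans ya xy); rewrite gt_eqF//; lra.
rewrite -[- calibR (u y)]add0r; apply: (@FTC_ray_right _ (fun x => calibR (u x)) gR).
- by move=> x xy; apply: is_derive_comp (du x); exact/is_derive_calibR/nz.
- move=> x xy; apply: continuousM; last exact: speed_continuous.
  by apply: continuous_comp_profile; apply: continuous_dcalibR; exact: nz.
- by move=> x xy; apply: gR_ge0; exact: le_trans xy.
- rewrite (_ : 0 = calibR 1); last by rewrite /calibR subrr mulr0 mul0r oppr0 mul0r.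
  apply: (cvg_comp _ _ uy); apply: (is_derive_continuous (is_derive_calibR _)).
  by rewrite gt_eqF//; lra.
Qed.

Let integrableR_G : integrableR G.
Proof.
have [iL _] := calibL_ray (lexx a); have [iR _] := calibR_ray (lexx a).
have iP : integrableR (fun x => gR a * \1_`[a, a] x).
  by apply: integrableRZ; exact: integrable_indic_itv.
(* The ray lemmas cover x <= a and a < x, whereas [G] takes its right branch at a; the indicator of
   the single point a corrects the value there. *)
have -> : G = (fun x => (x < a)%R%:R * ((x <= a)%R%:R * gL x) +
    ((a < x)%R%:R * gR x + gR a * \1_`[a, a] x)).
  apply/funext => x; rewrite /G indicE mem_setE in_itv/=.
  case: (ltgtP x a) => [xa|xa|->] /=; rewrite ?lexx; ring.
by apply: integrableRD; [exact: integrableR_lt|exact: integrableRD].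
Qed.

Let Rint_oriented_G y : \int[mu]_x (oriented_indic a x y * G x) = - F y.
Proof.
have [ya|ay] := ltP y a.
- have [iL rL] := calibL_ray (ltW ya).
  rewrite /F ya -rL -RintN//; apply: eq_Rintegral => x _.
  rewrite /oriented_indic ya /G.
  by case: (ltP y x) => yx; case: (ltP x a) => xa /=; [ring| ring|ring|exfalso; lra].
- have [_ rR] := calibR_ray ay.
  rewrite /F ltNge ay/= -rR; apply: eq_Rintegral => x _.
  rewrite /oriented_indic [(y < a)%R]ltNge ay /G.
  by case: (ltP y x) => yx; case: (ltP x a) => xa /=; [exfalso; lra| ring|ring|ring].
Qed.

Lemma weighted_poincare (d : R -> R) : measurable_fun setT d ->
  integrableR (fun x => d x ^+ 2) ->
  integrableR (fun x => speed x * mixing_weight (u x) * primitive a d x ^+ 2) ->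
  \int[mu]_x (speed x * mixing_weight (u x) * primitive a d x ^+ 2) <=
  \int[mu]_x ((5 - u x) / k * d x ^+ 2).
Proof.
move=> md d2i bzi.
have mp : measurable_fun setT (fun x => (5 - u x) / k).
  have := measurable_affine_profile (- k^-1) (5 / k).
  rewrite (_ : (fun x => (5 - u x) / k) = (fun x => - k^-1 * u x + 5 / k)) //.
  by apply/funext => x; ring.
have p0 x : 0 < (5 - u x) / k.
  by have /andP[_ u2] := ub x; rewrite divr_gt0//; lra.
apply: (calibration_le_L2 integrableR_G Rint_oriented_G) => //.
- move=> x; rewrite /G /F; case: ltP => xa; first by apply: riccatiL; exact: ltW.
  exact: riccatiR.
- move=> x; have /andP[m0 _] := mixing_weight_profile x.
  by rewrite mulr_ge0// ltW// speed_gt0.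
- apply: (integrableR_boundedM mp (M := 7 / k)) => // x.
  rewrite gtr0_norm//; have /andP[u1 _] := ub x.
  by rewrite ler_pM2r ?invr_gt0//; lra.
- apply: (integrableR_speedM measurable_mixing_weight (M := 50)) => x.
  by have /andP[m0 m1] := mixing_weight_profile x; rewrite ger0_norm.
Qed.

End split.

End profile.

(** * Smooth bumps *)

Section smooth.
Context {R : realType}.
Implicit Types f g : R -> R.

(** Recursion on the first derivative, rather than on [derive1n], lets sums, products and affine
    substitutions be handled by induction for all functions at once. *)
Fixpoint ntimes_derivable (n : nat) f : Prop :=
  if n is n'.+1 then (forall x, derivable f x 1) /\ ntimes_derivable n' f^`()%classic
  else True.

Definition smooth f : Prop := forall n, ntimes_derivable n f.

Lemma ntimes_derivableS n f f' : (forall x : R, is_derive x (1 : R) f (f' x)) ->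
  ntimes_derivable n f' -> ntimes_derivable n.+1 f.
Proof.
move=> df nf'; split => [x|]; first by have [] := df x.
rewrite (_ : f^`() = f')//; apply/funext => x.
by rewrite derive1E; have [_ ->] := df x.
Qed.

Lemma ntimes_derivable_is_derive n f : ntimes_derivable n.+1 f ->
  forall x : R, is_derive x (1 : R) f (f^`()%classic x).
Proof. by move=> [df _] x; rewrite derive1E; exact/derivableP/df. Qed.

Lemma ntimes_derivable_pred n f : ntimes_derivable n.+1 f -> ntimes_derivable n f.
Proof. by elim: n f => [//|n ih] f [df /ih nf]; split. Qed.

Lemma ntimes_derivable_cst n (c : R) : ntimes_derivable n (fun=> c).
Proof.
by elim: n c => [//|n ih] c; exact: (ntimes_derivableS (fun x => is_derive_cst c x 1)).
Qed.

Lemma ntimes_derivable_add n f g : ntimes_derivable n f -> ntimes_derivable n g ->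
  ntimes_derivable n (fun x => f x + g x).
Proof.
elim: n f g => [//|n ih] f g nf ng.
have dfg x := is_derive_add (ntimes_derivable_is_derive nf x)
  (ntimes_derivable_is_derive ng x).
by apply: (ntimes_derivableS dfg); apply: ih; [case: nf|case: ng].
Qed.

Lemma ntimes_derivable_mul n f g : ntimes_derivable n f -> ntimes_derivable n g ->
  ntimes_derivable n (fun x => f x * g x).
Proof.
elim: n f g => [//|n ih] f g nf ng.
have dfg x := is_derive_mul (ntimes_derivable_is_derive nf x)
  (ntimes_derivable_is_derive ng x).
apply: (ntimes_derivableS dfg); apply: ntimes_derivable_add; apply: ih; try exact: ntimes_derivable_pred.
- by case: nf.
- by case: ng.
Qed.

Lemma ntimes_derivable_affine n f (a b : R) : ntimes_derivable n f ->
  ntimes_derivable n (fun x => f (a * x + b)).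
Proof.
elim: n f => [//|n ih] f nf.
have dfa x := is_derive_comp (ntimes_derivable_is_derive nf _) (is_derive_affine a b x).
apply: (ntimes_derivableS dfa); apply: ntimes_derivable_mul; last exact: ntimes_derivable_cst.
by apply: ih; case: nf.
Qed.

Lemma smooth_derivable f : smooth f -> forall n x, derivable f^`(n)%classic x 1.
Proof.
move=> sf n x; have := sf n.+1; elim: n f {sf} => [|n ih] f [df nf]; first exact: df.
by rewrite derive1Sn; exact: ih.
Qed.

Lemma smooth_is_derive f : smooth f ->
  forall x : R, is_derive x (1 : R) f (f^`()%classic x).
Proof. by move=> sf; exact: (@ntimes_derivable_is_derive 0) (sf 1%N). Qed.

Lemma smooth_continuous f : smooth f -> continuous f.
Proof. by move=> sf x; exact: is_derive_continuous (smooth_is_derive sf x). Qed.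

Lemma is_derive_quadratic f (x C : R) : (forall h, `|f (h + x) - f x| <= C * h ^+ 2) ->
  is_derive x (1 : R) f 0.
Proof.
move=> fC.
have cv : h^-1 *: ((f \o shift x) (h *: (1 : R)) - f x) @[h --> 0^'] --> (0 : R).
  apply/cvgr0Pnorm_lt => e e0; near=> h.
  have h0 : h != 0 by near: h; exact: nbhs_dnbhs_neq.
  rewrite /= normrM normfV /GRing.scale/= mulr1 ltr_pdivrMl ?normr_gt0//.
  apply: (le_lt_trans (fC h)); rewrite -(real_normK (num_real h)) expr2 mulrA mulrC.
  rewrite ltr_pM2l ?normr_gt0//.
  apply: (@le_lt_trans _ _ ((`|C| + 1) * `|h|)).
    by apply: ler_wpM2r => //; apply: (le_trans (ler_norm C)); rewrite lerDl.
  rewrite -ltr_pdivlMl ?ltr_pwDr//; near: h.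
  by apply: dnbhs0_lt; rewrite mulr_gt0// invr_gt0 ltr_pwDr.
by apply: DeriveDef; [apply/cvg_ex; exists 0|exact/cvg_lim].
Unshelve. all: by end_near. Qed.

(** The functions x^(-n) exp(-1/x), extended by 0. As a family they are closed under differentiation
    up to linear combinations, so the smoothness of exp(-1/x) follows by an induction ranging over
    all n. *)
Definition flat (n : nat) (x : R) : R :=
  if 0 < x then x ^- n * expR (- x^-1) else 0.

Lemma flat_eq0 n x : x <= 0 -> flat n x = 0.
Proof. by rewrite /flat; case: ltP. Qed.

Lemma flat_ge0 n x : 0 <= flat n x.
Proof.
rewrite /flat; case: ltP => // x0.
by rewrite mulr_ge0 ?expR_ge0// invr_ge0 exprn_ge0// ltW.
Qed.

(** With y = 1/x, this is exp(y) >= y^(n+2)/(n+2)!. A quadratic bound is exactly what gives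
    derivative 0 at the origin. *)
Lemma flat_le n x : flat n x <= (n.+2)`!%:R * x ^+ 2.
Proof.
rewrite /flat; case: ltP => x0; last by rewrite mulr_ge0 ?sqr_ge0.
have y0 : 0 < x^-1 by rewrite invr_gt0.
have := @expR_ge1Dxn R x^-1 n.+1 (ltW y0) => h.
have {}h : x^-1 ^+ n.+2 / (n.+2)`!%:R <= expR x^-1.
  by apply: le_trans h; rewrite lerDr.
have f0 : 0 < (n.+2)`!%:R :> R by rewrite ltr0n fact_gt0.
rewrite expRN ler_pdivrMr ?expR_gt0// -mulrA mulrCA.
rewrite ler_pdivrMr// in h.
have -> : x ^- n = x ^+ 2 * x^-1 ^+ n.+2.
  by rewrite exprVn -[n.+2]addn2 exprD invfM mulrCA divff ?mulr1// expf_neq0// gt_eqF.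
by apply: ler_wpM2l; rewrite ?sqr_ge0// mulrC.
Qed.

Lemma flat0_le1 x : flat 0 x <= 1.
Proof.
rewrite /flat; case: ltP => // x0.
by rewrite expr0 invr1 mul1r -expR0 ler_expR oppr_le0 invr_ge0 ltW.
Qed.

Lemma is_derive_flat n (x : R) :
  is_derive x (1 : R) (flat n) (flat n.+2 x - n%:R * flat n.+1 x).
Proof.
have [x0|x0|->] := ltgtP x 0.
- apply: (@near_eq_is_derive _ _ _ (fun=> 0)).
    near=> y; rewrite /flat ltNge ltW//; near: y; exact: lt_nbhsl.
  by rewrite /flat ltNge ltW//= mulr0 subr0; exact: is_derive_cst.
  apply: (@near_eq_is_derive R R R (fun y : R => (y ^+ n)^-1 * expR (- y^-1) : R)).
    near=> y; rewrite /flat ifT//; near: y; exact: lt_nbhsr.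
  have x1 : x != 0 by rewrite gt_eqF.
  have dV : is_derive x (1 : R) (fun y => y^-1) (- x ^- 2).
    by apply: (is_derive_eq (is_deriveV x1 (is_derive_id x 1))); rewrite /GRing.scale/= mulr1.
  have dX : is_derive x (1 : R) (fun y : R => y ^+ n) (n%:R * x ^+ n.-1).
    have := is_deriveX n (is_derive_id x (1 : R)); rewrite exprfctE => h.
    by apply: (is_derive_eq h); rewrite /GRing.scale/= mulr1.
  have xn : x ^+ n != 0 by rewrite expf_neq0.
  have dXV := is_deriveV (f := fun y : R => y ^+ n) xn dX.
  have dE := is_derive_comp (g := fun y : R => - y^-1) (is_derive_expR (- x^-1)) (is_derive_opp dV).
  apply: (is_derive_eq (is_derive_mul dXV dE)).
  rewrite /flat x0 /GRing.scale/= opprK.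
  case: n {dX dXV} xn => [|n] xn; rewrite ?mul0r ?expr0 ?mulr0 ?invr1 ?subr0 /=.
    by rewrite mul0r add0r mul1r mulrC.
  by rewrite !exprS; field; rewrite x1 expf_neq0.
- apply: (is_derive_eq (is_derive_quadratic (C := (n.+2)`!%:R) _)).
    move=> h; rewrite addr0 [flat n 0]/flat ltxx subr0 ger0_norm ?flat_ge0//.
    exact: flat_le.
  by rewrite /flat ltxx mulr0 subr0.
Unshelve. all: by end_near. Qed.

Lemma smooth_flat n : smooth (flat n).
Proof.
move=> k; elim: k n => [//|k ih] n.
apply: ntimes_derivableS (is_derive_flat n) _.
under eq_fun do rewrite -mulNr.
apply: ntimes_derivable_add; first exact: ih.
by apply: ntimes_derivable_mul; [exact: ntimes_derivable_cst|exact: ih].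
Qed.

(** Not a mollifier: each factor is exp(-1/((n+1) t)), with t the distance to an endpoint, and tends
    to 1 for t > 0. The bumps stay below the indicator of ]a, b[ and converge to it pointwise, which
    suits dominated convergence. *)
Definition bump_function (a b : R) (n : nat) (x : R) : R :=
  flat 0 (n.+1%:R * (x - a)) * flat 0 (n.+1%:R * (b - x)).

Lemma smooth_bump a b n : smooth (bump_function a b n).
Proof.
move=> k; apply: ntimes_derivable_mul.
  under eq_fun do rewrite mulrBr.
  exact/ntimes_derivable_affine/smooth_flat.
under eq_fun do rewrite mulrBr addrC -mulNr.
exact/ntimes_derivable_affine/smooth_flat.
Qed.

Lemma bump_ge0 a b n x : 0 <= bump_function a b n x.
Proof. by rewrite mulr_ge0 ?flat_ge0. Qed.

Lemma bump_le a b n x : bump_function a b n x <= \1_`]a, b[ x.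
Proof.
rewrite indicE mem_setE in_itv/= /bump_function.
have [ax|xa] := ltP a x; last first.
  by rewrite flat_eq0 ?mul0r// mulr_ge0_le0 ?subr_le0.
have [xb|bx] := ltP x b; last first.
  by rewrite [X in _ * X]flat_eq0 ?mulr0// mulr_ge0_le0 ?subr_le0.
by rewrite -[leRHS]mulr1 ler_pM ?flat_ge0 ?flat0_le1.
Qed.

Lemma cvg_bump a b x : bump_function a b n x @[n --> \oo] --> (\1_`]a, b[ x : R).
Proof.
have [xab|xab] := boolP (x \in `]a, b[%classic); last first.
  have e n : bump_function a b n x = 0.
    apply/eqP; rewrite eq_le bump_ge0 andbT.
    by apply: (le_trans (bump_le _ _ _ _)); rewrite indicE (negbTE xab).
  by under eq_fun do rewrite e; rewrite indicE (negbTE xab); exact: cvg_cst.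
have key c : 0 < c -> flat 0 (n.+1%:R * c) @[n --> \oo] --> (1 : R).
  move=> c0; rewrite (_ : (fun n => _) = fun n => expR (- (c^-1 * n.+1%:R^-1))); last first.
    apply/funext => n; rewrite /flat mulr_gt0// expr0 invr1 mul1r.
    by rewrite invfM mulrC.
  have h0 : - (c^-1 * n.+1%:R^-1) @[n --> \oo] --> - (c^-1 * 0).
    by apply: cvgN; apply: cvgMr; exact: cvg_harmonic.
  rewrite mulr0 oppr0 in h0.
  by have := cvg_comp _ _ h0 (@continuous_expR R 0); rewrite expR0.
rewrite indicE xab; move: xab; rewrite mem_setE in_itv/= => /andP[ax xb].
have := cvgM (key (x - a) _) (key (b - x) _); rewrite !subr_gt0 mulr1.
by apply.
Qed.

End smooth.

(** * Weak derivatives *)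

Section weak_derivative.
Context {R : realType}.
Local Notation mu := (@lebesgue_measure R).
Local Notation RT := (measurableTypeR R).
Implicit Types f g h psi phi d : R -> R.

Lemma cutoff_id (M x : R) : `|x| <= M -> cutoff M x = 1.
Proof. by rewrite /cutoff => ->. Qed.

Lemma cutoff_supp (M : R) psi x : (forall x, M < `|x| -> psi x = 0) ->
  cutoff M x * psi x = psi x.
Proof.
move=> psi0; rewrite /cutoff; case: leP => [_|/psi0 ->]; first by rewrite mul1r.
by rewrite mulr0.
Qed.

Lemma integrableR_le_ind (y : R) f : integrableR f ->
  integrableR (fun x => (x <= y)%R%:R * f x).
Proof.
move=> fi; have -> : (fun x => (x <= y)%R%:R * f x) = (fun x => f x - (y < x)%R%:R * f x).
  by apply/funext => x; case: (leP x y) => _; rewrite /= ?mul1r ?mul0r ?subr0 ?subrr.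
apply: integrableRB => //; apply: (@integrableR_boundedM _ _ 1) => //.
  exact: (@measurable_indic_lt _ _ RT (cst y) id).
by move=> x; case: (y < x)%R; rewrite ?normr1 ?normr0 ?lexx ?ler01.
Qed.

(** To the left of the support of [psi] the antiderivative is trivially zero; to the right it equals
    the full integral, so the zero mean is what makes its support bounded. *)
Lemma antiderivative_is_test psi (M : R) : smooth psi -> integrableR psi ->
  (forall x, M < `|x| -> psi x = 0) -> \int[mu]_x psi x = 0 ->
  let eta y := \int[mu]_x ((x <= y)%R%:R * psi x) in
  [/\ is_test_function eta, eta^`()%classic = psi & forall x, M < `|x| -> eta x = 0].
Proof.
move=> spsi ipsi psi0 int0 eta.
have etaE : eta = fun y => \int[mu]_(x in `]-oo, y]) psi x.
  apply/funext => y; rewrite Rintegral_mkcond; apply: eq_Rintegral => x _.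
  rewrite patchE mem_setE in_itv/=.
  by case: (x <= y)%R; rewrite ?mul1r ?mul0r.
have deta x : is_derive x (1 : R) eta (psi x).
  rewrite etaE; have [||||dF eF] := @continuous_FTC1 R psi -oo%O x (x + 1).
  - by rewrite ltrDl.
  - by apply: (integrableS _ _ _ ipsi).
  - by rewrite ltNyr.
  - exact: smooth_continuous.
  by apply: DeriveDef; [exact: dF|rewrite -derive1E; exact: eF].
have seta : smooth eta by case => [//|n]; exact: ntimes_derivableS deta (spsi n).
have eta0 x : M < `|x| -> eta x = 0.
  move=> Mx; have [x0|x0] := leP 0 x.
    rewrite -[RHS]int0; apply: eq_Rintegral => y _.
    case: (leP y x) => xy; first by rewrite mul1r.
    rewrite mul0r psi0// (lt_le_trans Mx)// ger0_norm// ger0_norm ?ltW//.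
    exact: le_lt_trans xy.
  rewrite -[RHS](mul0r (fine (mu setT))) -Rintegral_cst//.
  apply: eq_Rintegral => y _; case: (leP y x) => xy; last by rewrite mul0r.
  rewrite mul1r psi0// (lt_le_trans Mx)// ltr0_norm// ltr0_norm; last exact: le_lt_trans x0.
  by rewrite lerN2.
split => //.
- by split; [exact: smooth_derivable|exists M].
- by apply/funext => x; rewrite derive1E; have [_ ->] := deta x.
Qed.

Lemma integrableR_cutoff_primitive (a M : R) d : `|a| <= M -> measurable_fun setT d ->
  integrableR (fun x => d x ^+ 2) ->
  integrableR (fun x => cutoff M x * primitive a d x).
Proof.
move=> aM md di; set dM := fun y => cutoff M y * d y.
have dMi : integrableR dM by exact: integrableR_cutoff_sqr.
have -> : (fun x => cutoff M x * primitive a d x) =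
    (fun x => primitive a dM x * cutoff M x).
  apply/funext => x; rewrite mulrC /cutoff.
  case: leP => xM; last by rewrite !mulr0.
  by rewrite !mulr1 primitive_cutoff.
apply: (@integrableR_boundedM _ _ (\int[mu]_y `|dM y|)).
- by apply: measurable_primitive; exact: integrableR_measurable.
- by move=> x; exact: primitive_bound.
- exact: integrableR_cutoff.
Qed.

(** Let eta be the antiderivative of [psi]. The weak derivative turns the integral of phi psi into
    minus that of d eta; Fubini turns the integral of (primitive a d) psi into the same quantity. *)
Lemma weak_derivative_primitive (a M C : R) phi d psi : `|a| <= M ->
  measurable_fun setT phi -> integrableR (fun x => phi x ^+ 2) ->
  measurable_fun setT d -> integrableR (fun x => d x ^+ 2) ->
  is_weak_derivative phi d ->
  smooth psi -> (forall x, M < `|x| -> psi x = 0) -> (forall x, `|psi x| <= C) ->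
  integrableR psi -> \int[mu]_x psi x = 0 ->
  \int[mu]_x ((phi x - primitive a d x) * psi x) = 0.
Proof.
move=> aM mphi phi2 md d2 wd spsi psi0 psiC ipsi int0.
set dM := fun y => cutoff M y * d y.
have dMi : integrableR dM by exact: integrableR_cutoff_sqr.
have mpsi := integrableR_measurable ipsi.
pose eta y := \int[mu]_x ((x <= y)%R%:R * psi x).
have [test detaE eta0] : [/\ is_test_function eta, eta^`()%classic = psi &
    forall x, M < `|x| -> eta x = 0] := antiderivative_is_test spsi ipsi psi0 int0.
have psiM f : integrableR (fun x => cutoff M x * f x) -> integrableR (fun x => f x * psi x).
  move=> fi; have -> : (fun x => f x * psi x) = (fun x => psi x * (cutoff M x * f x)).
    by apply/funext => x; rewrite mulrCA [psi x * f x]mulrC mulrCA (cutoff_supp x psi0).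
  exact: (integrableR_boundedM mpsi psiC).
have i1 := psiM _ (integrableR_cutoff_sqr M mphi phi2).
have i2 := psiM _ (integrableR_cutoff_primitive aM md d2).
have -> : \int[mu]_x ((phi x - primitive a d x) * psi x) =
    \int[mu]_x (phi x * psi x) - \int[mu]_x (primitive a d x * psi x).
  by rewrite -RintB//; apply: eq_Rintegral => x _; rewrite mulrBl.
have := wd eta test; rewrite detaE => ->.
have -> : \int[mu]_x (primitive a d x * psi x) =
    \int[mu]_x (psi x * primitive a dM x).
  apply: eq_Rintegral => x _; rewrite mulrC.
  have [xM|/psi0 ->] := leP `|x| M; last by rewrite !mul0r.
  by rewrite primitive_cutoff.
rewrite (fubini_kernel (measurable_oriented_indic a) _ ipsi dMi); last first.
  by move=> q; exact: normr_oriented_indic.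
have -> : \int[mu]_y (dM y * \int[mu]_x (oriented_indic a x y * psi x)) =
    \int[mu]_y (- (d y * eta y)).
  apply: eq_Rintegral => y _.
  have [yM|My] := leP `|y| M; last first.
    by rewrite /dM /cutoff leNgt My mul0r mul0r eta0// mulr0 oppr0.
  rewrite /dM cutoff_id// mul1r -mulrN; congr (_ * _).
  (* A multiple of the integral of [psi], which is zero, is added to recover the oriented kernel;
     this is how the base point a drops out. *)
  have -> : - eta y = \int[mu]_x ((1 - (y < a)%R%:R) * psi x - (x <= y)%R%:R * psi x).
    rewrite RintB; [|exact: integrableRZ|exact: integrableR_le_ind].
    by rewrite RintZ// int0 mulr0 sub0r.
  apply: eq_Rintegral => x _; rewrite /oriented_indic.
  by case: (leP x y) => _ /=; ring.
rewrite RintN ?opprK ?addNr//.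
have -> : (fun y => d y * eta y) = (fun y => eta y * dM y).
  apply/funext => y; rewrite /dM; have [yM|/eta0 ->] := leP `|y| M.
    by rewrite cutoff_id// mul1r mulrC.
  by rewrite mulr0 mul0r.
apply: (@integrableR_boundedM _ _ (\int[mu]_x `|psi x|)) => //.
  have [testd _] := test; apply: continuous_measurable_fun => y.
  apply: differentiable_continuous; apply/derivable1_diffP.
  exact: (testd 0%N).
move=> y; apply: le_trans (le_normr_Rintegral measurableT _) _.
  exact: integrableR_le_ind.
apply: Rint_le; [exact/integrableR_norm/integrableR_le_ind|exact: integrableR_norm|].
by move=> x; rewrite normrM; case: (x <= y)%R; rewrite ?normr1 ?mul1r// normr0 mul0r.
Qed.

Lemma Rint_indic_itv (a b : R) : a < b -> \int[mu]_x (\1_`]a, b[ x : R) = b - a.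
Proof.
move=> ab; rewrite /Rintegral integral_indic// setIT.
transitivity (fine (b%:E - a%:E)%E) => //; congr fine.
by have := lebesgue_measure_itv `]a, b[%R; rewrite /= lte_fin ab.
Qed.

Lemma integrableR_indic_itvM (a b M : R) f : `|a| <= M -> `|b| <= M ->
  integrableR (fun x => cutoff M x * f x) ->
  integrableR (fun x => \1_`]a, b[ x * f x).
Proof.
move=> aM bM fi; have -> : (fun x => \1_`]a, b[ x * f x) =
    (fun x => \1_`]a, b[ x * (cutoff M x * f x)).
  apply/funext => x; rewrite indicE mem_setE in_itv/=.
  case: andP => [[ax xb]|_]; last by rewrite !mul0r.
  rewrite cutoff_id ?mul1r//; move: aM bM; rewrite !ler_norml => /andP[? ?] /andP[? ?].
  by apply/andP; split; lra.
have mI : measurable_fun setT (\1_`]a, b[ : R -> R) by exact: measurable_indic.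
apply: (integrableR_boundedM (M := 1) mI) => //.
by move=> x; rewrite indicE; case: (x \in _); rewrite ?normr1 ?normr0.
Qed.

(** On ]-N, N[ the indefinite integral of [f] from -N vanishes identically, and by Lebesgue
    differentiation its derivative is [f] almost everywhere. Countably many N cover the line. *)
Lemma ae_eq0_of_Rint_itv f :
  (forall M, integrableR (fun x => cutoff M x * f x)) ->
  (forall a b, a < b -> \int[mu]_x (\1_`]a, b[ x * f x) = 0) ->
  {ae mu, forall x, f x = 0}.
Proof.
move=> fi f0.
suff h (N : nat) : {ae mu, forall x, `|x| < N%:R -> f x = 0}.
  have : {ae mu, forall x (N : nat), `|x| < N%:R -> f x = 0} := ae_foralln h.
  apply: filterS; first exact: (ae_filter_ringOfSetsType mu).
  move=> x fx; near \oo => n; apply: (fx n); near: n.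
  exact: nbhs_infty_gtr.
set M : R := N%:R; set g := fun x => cutoff M x * f x.
have gi : integrableR g by exact: fi.
have gis (i : interval R) : mu.-integrable [set` i] (EFin \o g).
  by apply: (integrableS _ _ _ gi).
have F0 x : `|x| < M -> \int[mu]_(t in `]- M, x]) g t = 0.
  rewrite ltr_norml => /andP[Mx xM].
  rewrite -Rintegral_itv_bndo_bndc; last exact: gis.
  rewrite -[RHS](f0 _ _ Mx) Rintegral_mkcond; apply: eq_Rintegral => t _.
  rewrite patchE indicE mem_setE in_itv/=.
  have [/andP[tM tx]|_] := boolP (- M < t < x); last by rewrite mul0r.
  by rewrite /g cutoff_id ?mul1r// ler_norml !ltW//= (lt_trans tx).
have lg : locally_integrable setT g by apply: open_integrable_locally => //; exact: openT.
have := @FTC1 R g (BRight (- M)) (fun y => gis _) lg.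
apply: filterS; first exact: (ae_filter_ringOfSetsType mu).
move=> x /= dFx xM; have [Mx xM'] : - M < x /\ x < M by move: xM; rewrite ltr_norml => /andP.
have [_] := dFx Mx; rewrite /g cutoff_id ?mul1r ?ltW// => <-.
rewrite derive1E -[RHS](derive_cst (0 : R) x (1 : R)); apply: near_eq_derive.
near=> y; apply: F0; rewrite ltr_norml; apply/andP; split; near: y.
  exact: lt_nbhsr.
exact: lt_nbhsl.
Unshelve. all: by end_near. Qed.

Lemma cutoff_mul (M N x : R) : M <= N -> cutoff M x * cutoff N x = cutoff M x.
Proof.
move=> MN; rewrite {1 3}/cutoff; case: leP => xM; last by rewrite mul0r.
by rewrite mul1r cutoff_id// (le_trans xM).
Qed.

Lemma bump_supp (a b M : R) n x : `|a| <= M -> `|b| <= M -> M < `|x| ->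
  bump_function a b n x = 0.
Proof.
move=> aM bM Mx; apply/eqP; rewrite eq_le bump_ge0 andbT.
apply: (le_trans (bump_le _ _ _ _)); rewrite indicE mem_setE in_itv/=.
case: andP => // -[ax xb]; exfalso; move: Mx; apply/negP; rewrite -leNgt.
by move: aM bM; rewrite !ler_norml => /andP[? ?] /andP[? ?]; apply/andP; split; lra.
Qed.

Lemma integrableR_bump (a b : R) n : integrableR (bump_function a b n).
Proof.
apply: (@integrableR_le _ _ (\1_`]a, b[)).
- by apply: continuous_measurable_fun; exact/smooth_continuous/smooth_bump.
- by move=> x; rewrite ger0_norm ?bump_ge0 ?bump_le.
- exact: integrable_indic_itv.
Qed.

Lemma cvg_Rint_bump (a b : R) f :
  (forall M, integrableR (fun x => cutoff M x * f x)) -> measurable_fun setT f ->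
  \int[mu]_x (f x * bump_function a b n x) @[n --> \oo] -->
  \int[mu]_x (\1_`]a, b[ x * f x).
Proof.
move=> fi mf.
have mI : measurable_fun setT (\1_`]a, b[ : R -> R) by exact: measurable_indic.
have aM : `|a| <= `|a| + `|b| by rewrite lerDl.
have bM : `|b| <= `|a| + `|b| by rewrite lerDr.
have Ifi := integrableR_indic_itvM aM bM (fi _).
have -> : \int[mu]_x (\1_`]a, b[ x * f x) = \int[mu]_x (f x * \1_`]a, b[ x).
  by apply: eq_Rintegral => x _; rewrite mulrC.
apply: (Rint_dominated_cvg _ _ _ (integrableR_norm Ifi)).
- move=> n; apply: measurable_funM => //.
  by apply: continuous_measurable_fun; exact/smooth_continuous/smooth_bump.
- exact: measurable_funM.
- by move=> x; apply: cvgMr; exact: cvg_bump.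
- move=> n x; rewrite normrM [leRHS]normrM mulrC ler_wpM2r//.
  rewrite (ger0_norm (bump_ge0 _ _ _ _)); apply: (le_trans (bump_le _ _ _ _)).
  exact: ler_norm.
Qed.

(* Testing against the antiderivative of a combination with zero mean of the bumps on
   ]b, e[ and ]0, 1[ shows that phi - primitive a d has the same mean on all intervals. *)
Lemma weak_derivative_representative (a : R) phi d :
  measurable_fun setT phi -> integrableR (fun x => phi x ^+ 2) ->
  measurable_fun setT d -> integrableR (fun x => d x ^+ 2) ->
  is_weak_derivative phi d ->
  exists m, {ae mu, forall x, phi x = m + primitive a d x}.
Proof.
move=> mphi phi2 md d2 wd.
pose h x := phi x - primitive a d x.
have mh : measurable_fun setT h by apply: measurable_funB => //; exact: measurable_primitive.
have hi M : integrableR (fun x => cutoff M x * h x).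
  pose N := Num.max M `|a|.
  have hN : integrableR (fun x => cutoff N x * h x).
    under eq_fun do rewrite mulrBr; apply: integrableRB; first exact: integrableR_cutoff_sqr.
    by apply: integrableR_cutoff_primitive; rewrite // le_max lexx orbT.
  have -> : (fun x => cutoff M x * h x) = (fun x => cutoff M x * (cutoff N x * h x)).
    by apply/funext => x; rewrite mulrA cutoff_mul// le_max lexx.
  exact: (integrableR_boundedM (measurable_cutoff M) (normr_cutoff M)).
have key b e n : b < e ->
    (\int[mu]_x bump_function 0 1 n x) * \int[mu]_x (h x * bump_function b e n x) =
    (\int[mu]_x bump_function b e n x) * \int[mu]_x (h x * bump_function 0 1 n x).
  move=> be; set rho := bump_function 0 1 n; set theta := bump_function b e n.
  set r := \int[mu]_x rho x; set t := \int[mu]_x theta x.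
  have ri : integrableR rho by exact: integrableR_bump.
  have ti : integrableR theta by exact: integrableR_bump.
  pose psi x := r * theta x - t * rho x.
  pose M := `|a| + 1 + `|b| + `|e|.
  have := normr_ge0 a; have := normr_ge0 b; have := normr_ge0 e => e0 b0 a0.
  have [aM bM eM] : [/\ `|a| <= M, `|b| <= M & `|e| <= M] by rewrite /M; split; lra.
  have [M0 M1] : `|0 : R| <= M /\ `|1 : R| <= M by rewrite normr0 normr1 /M; split; lra.
  have ipsi : integrableR psi by apply: integrableRB; exact: integrableRZ.
  have bump1 (p q : R) x : `|bump_function p q n x| <= 1.
    rewrite ger0_norm ?bump_ge0//; apply: (le_trans (bump_le _ _ _ _)).
    by rewrite indicE; case: (x \in _).
  have hb (p q : R) : `|p| <= M -> `|q| <= M -> integrableR (fun x => h x * bump_function p q n x).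
    move=> pM qM; have -> : (fun x => h x * bump_function p q n x) =
        (fun x => bump_function p q n x * (cutoff M x * h x)).
      apply/funext => x; rewrite -[X in h x * X = _](@cutoff_supp M); first by ring.
      by move=> y; exact: bump_supp.
    apply: (integrableR_boundedM _ (bump1 p q) (hi M)).
    by apply: continuous_measurable_fun; exact/smooth_continuous/smooth_bump.
  have int0 : \int[mu]_x psi x = 0.
    rewrite RintB; [|exact: integrableRZ..].
    by rewrite (RintZ _ ti) (RintZ _ ri) mulrC subrr.
  have spsi : smooth psi.
    move=> k; rewrite /psi; under eq_fun do rewrite -mulNr.
    by apply: ntimes_derivable_add; apply: ntimes_derivable_mul;
      [exact: ntimes_derivable_cst|exact: smooth_bump|
       exact: ntimes_derivable_cst|exact: smooth_bump].
  have psi0 x : M < `|x| -> psi x = 0.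
    move=> Mx; have t0 : theta x = 0 by exact: bump_supp bM eM Mx.
    have r0 : rho x = 0 by exact: bump_supp M0 M1 Mx.
    by rewrite /psi t0 r0 !mulr0 subrr.
  have psiC x : `|psi x| <= `|r| + `|t|.
    apply: (le_trans (ler_normB _ _)); rewrite [`|r * _|]normrM [`|t * _|]normrM.
    by apply: lerD; apply: ler_piMr => //; exact: bump1.
  have := weak_derivative_primitive aM mphi phi2 md d2 wd spsi psi0 psiC ipsi int0.
  have -> : \int[mu]_x ((phi x - primitive a d x) * psi x) =
      \int[mu]_x (r * (h x * theta x) - t * (h x * rho x)).
    by apply: eq_Rintegral => x _; rewrite /psi /h; ring.
  rewrite RintB; [|exact/integrableRZ/hb..].
  by rewrite !RintZ; [move/eqP; rewrite subr_eq0 => /eqP|exact: hb..].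
pose c := \int[mu]_x (\1_`]0, 1[ x * h x).
have cvg1 b e : b < e -> \int[mu]_x bump_function b e n x @[n --> \oo] --> e - b.
  move=> be; rewrite -Rint_indic_itv//.
  have Ii : integrableR (\1_`]b, e[ : R -> R) by exact: integrable_indic_itv.
  apply: (Rint_dominated_cvg _ _ (@cvg_bump R b e) Ii).
  - by move=> n; exact: integrableR_measurable (integrableR_bump b e n).
  - exact: measurable_indic.
  - by move=> n x; rewrite ger0_norm ?bump_ge0 ?bump_le.
(* Letting n tend to infinity in [key] replaces the bumps by indicators: the mean of [h] over ]b, e[
   equals its mean [c] over ]0, 1[, which is therefore the constant sought. *)
have hc b e : b < e -> \int[mu]_x (\1_`]b, e[ x * h x) = (e - b) * c.
  move=> be.
  have l1 := cvgM (cvg1 _ _ ltr01) (@cvg_Rint_bump b e _ hi mh).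
  have l2 := cvgM (cvg1 _ _ be) (@cvg_Rint_bump 0 1 _ hi mh).
  have l3 : (fun n => (\int[mu]_x bump_function 0 1 n x) *
      \int[mu]_x (h x * bump_function b e n x)) @ \oo --> (e - b) * c.
    have -> : (fun n => (\int[mu]_x bump_function 0 1 n x) *
        \int[mu]_x (h x * bump_function b e n x)) =
        (fun n => (\int[mu]_x bump_function b e n x) *
        \int[mu]_x (h x * bump_function 0 1 n x)) by apply/funext => n; exact: key.
    exact: l2.
  by have := cvg_unique _ (l1 _) l3; rewrite subr0 mul1r; apply.
exists c; have : {ae mu, forall x, h x - c = 0}.
  apply: (@ae_eq0_of_Rint_itv (fun x => h x - c)) => [M|b e be].
    under eq_fun do rewrite mulrBr; apply: integrableRB => //.
    under eq_fun do rewrite mulrC; exact/integrableRZ/integrableR_cutoff.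
  have bM : `|b| <= `|b| + `|e| by rewrite lerDl.
  have eM : `|e| <= `|b| + `|e| by rewrite lerDr.
  have Ih := integrableR_indic_itvM bM eM (hi _).
  have Ii : integrableR (\1_`]b, e[ : R -> R) by exact: integrable_indic_itv.
  have -> : \int[mu]_x (\1_`]b, e[ x * (h x - c)) =
      \int[mu]_x (\1_`]b, e[ x * h x) - c * \int[mu]_x (\1_`]b, e[ x).
    rewrite -RintZ// -RintB//; last exact: integrableRZ.
    by apply: eq_Rintegral => x _; ring.
  by rewrite hc// Rint_indic_itv//; ring.
apply: filterS; first exact: (ae_filter_ringOfSetsType mu).
by move=> x /= /eqP; rewrite subr_eq0 /h subr_eq => /eqP.
Qed.

End weak_derivative.

(** * Boundedness of H^1 functions *)

Section bounded.
Context {R : realType}.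
Local Notation mu := (@lebesgue_measure R).
Implicit Types f g d w : R -> R.

Lemma integrableR_ae f g : measurable_fun setT f -> {ae mu, forall x, f x = g x} ->
  integrableR g -> integrableR f.
Proof.
move=> mf fg gi; have mg := integrableR_measurable gi.
apply/integrableP; split; first exact/measurable_EFinP.
have /integrableP[_] := gi; apply: le_lt_trans; rewrite le_eqVlt; apply/orP; left.
apply/eqP; apply: ae_eq_integral => //.
- by apply/measurable_EFinP; exact: measurableT_comp.
- by apply/measurable_EFinP; exact: measurableT_comp.
- move: fg; apply: filterS; first exact: (ae_filter_ringOfSetsType mu).
  by move=> x /= -> _.
Qed.

Lemma integrableR_oriented_L2 (a x : R) d : measurable_fun setT d ->
  integrableR (fun y => d y ^+ 2) -> integrableR (fun y => oriented_indic a x y * d y).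
Proof.
move=> md d2; pose M := `|a| + `|x|.
have -> : (fun y => oriented_indic a x y * d y) =
    (fun y => oriented_indic a x y * (cutoff M y * d y)).
  apply/funext => y; have := ler_norm a; have := ler_norm x.
  have := ler_norm (- a); have := ler_norm (- x); rewrite !normrN => x1 a1 x2 a2.
  rewrite mulrA; congr (_ * _); rewrite /cutoff /oriented_indic ler_norml /M.
  case: (ltP y x); case: (ltP y a); case: (lerP (- (`|a| + `|x|)) y);
    case: (lerP y (`|a| + `|x|)) => /= *; by [lra | exfalso; lra].
exact/integrableR_oriented/integrableR_cutoff_sqr.
Qed.

Lemma primitive_chasles (a x y : R) d : measurable_fun setT d ->
  integrableR (fun t => d t ^+ 2) ->
  primitive a d y - primitive a d x = primitive x d y.
Proof.
move=> md d2; rewrite /primitive -RintB; [|exact: integrableR_oriented_L2..].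
by apply: eq_Rintegral => t _; rewrite /oriented_indic; ring.
Qed.

Lemma primitive_local_bound (x y : R) d : measurable_fun setT d ->
  integrableR (fun t => d t ^+ 2) -> x < y < x + 1 ->
  `|primitive x d y| <= 2 + \int[mu]_t (d t ^+ 2).
Proof.
move=> md d2 /andP[xy yx].
(* On [x, y[ one has |d| <= 1 + d^2. The open interval starts at x - 1 so as to contain the endpoint
   t = x; its length is the 2 of the bound. *)
have Ii : integrableR (\1_`]x - 1, x + 1[ : R -> R) by exact: integrable_indic_itv.
have oi := integrableR_oriented_L2 x y md d2.
apply: (le_trans (le_normr_Rintegral measurableT oi)).
apply: (@le_trans _ _ (\int[mu]_t (\1_`]x - 1, x + 1[ t + d t ^+ 2))); last first.
  by rewrite RintD// Rint_indic_itv; lra.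
apply: Rint_le; [exact: integrableR_norm|exact: integrableRD|move=> t].
rewrite normrM indicE mem_setE in_itv/=.
have d0 := normr_ge0 (d t); have dd := real_normK (num_real (d t)).
rewrite -dd /oriented_indic.
case: (ltP t y) => ty; case: (ltP t x) => tx /=; rewrite ?subrr ?subr0 ?sub0r ?normrN
  ?normr0 ?normr1 ?mul0r ?addr_ge0 ?sqr_ge0//.
  have -> : (x - 1 < t < x + 1) by apply/andP; split; lra.
  by rewrite mul1r /=; nra.
by exfalso; lra.
Qed.

(* On ]x, x + 1[ the function stays within 2 + ||d||^2 of its value at x, so a large value
   would contradict square integrability. *)
Lemma H1_bounded (a m : R) d phi : measurable_fun setT d ->
  integrableR (fun x => d x ^+ 2) -> integrableR (fun x => phi x ^+ 2) ->
  {ae mu, forall x, phi x = m + primitive a d x} ->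
  exists M, forall x, `|m + primitive a d x| <= M.
Proof.
move=> md d2 phi2 ae; pose w x := m + primitive a d x.
have mw : measurable_fun setT w.
  by apply: measurable_funD => //; exact: measurable_primitive.
have w2 : integrableR (fun x => w x ^+ 2).
  apply: integrableR_ae phi2; first exact: measurable_funX.
  move: ae; apply: filterS; first exact: (ae_filter_ringOfSetsType mu).
  by move=> x /= ->.
pose K := 2 + \int[mu]_t (d t ^+ 2).
pose B := 2 * \int[mu]_t (w t ^+ 2) + 2 * K ^+ 2.
have K0 : 0 <= K by rewrite addr_ge0// Rintegral_ge0// => t _; exact: sqr_ge0.
have B0 : 0 <= B.
  rewrite addr_ge0 ?mulr_ge0 ?sqr_ge0// Rintegral_ge0// => t _; exact: sqr_ge0.
exists (1 + B) => x; rewrite -/(w x).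
have : w x ^+ 2 <= B.
  have Ii : integrableR (\1_`]x, x + 1[ : R -> R) by exact: integrable_indic_itv.
  have e : \int[mu]_y (w x ^+ 2 * \1_`]x, x + 1[ y) = w x ^+ 2.
    by rewrite RintZ// Rint_indic_itv ?ltrDl// addrAC subrr add0r mulr1.
  have f : \int[mu]_y (2 * w y ^+ 2 + 2 * K ^+ 2 * \1_`]x, x + 1[ y) = B.
    rewrite RintD ?RintZ//; [|exact: integrableRZ..].
    by rewrite Rint_indic_itv ?ltrDl// [x + 1]addrC addrK mulr1.
  rewrite -e -f; apply: Rint_le; first exact: integrableRZ.
    by apply: integrableRD; exact: integrableRZ.
  move=> y; rewrite indicE mem_setE in_itv/=; case: (boolP (x < y < x + 1)) => [xy|_]; last first.
    by rewrite !mulr0 addr0 mulr_ge0 ?sqr_ge0.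
  have := primitive_local_bound md d2 xy; rewrite -/K => pK.
  have ch : w y - w x = primitive x d y by rewrite -(primitive_chasles a)// /w; ring.
  have : (w y - w x) ^+ 2 <= K ^+ 2.
    rewrite ch -(real_normK (num_real (primitive x d y))).
    by rewrite lerXn2r ?nnegrE ?normr_ge0.
  rewrite !mulr1 => h; have := sqr_ge0 (2 * w y - w x); nra.
have := normr_ge0 (w x); rewrite -(real_normK (num_real (w x))); nra.
Qed.

End bounded.

(** Both w^2 and the linear form squared, [L]^2, are controlled by z^2 and m^2, and w^4 <= 2 (w^2 +
    L)^2 + 2 L^2. Collecting terms leaves 2 (w^2 + L)^2 + 130 z^2 + 176 m^2; the tightest
    requirement on the constant is 4000/25 = 160 >= 130. *)
Lemma coercivity_pointwise (R : realFieldType) (s w z m : R) : - 2 < s < 1 -> w = m + z ->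
  w ^+ 2 + w ^+ 4 <= 4000 * (3 / 4 * (w ^+ 2 + 2 / 3 * ((5 + s) * w + 5 * m)) ^+ 2
    + z ^+ 2 / 25 + m ^+ 2 / 2).
Proof.
move=> /andP[s1 s2] ->; set w' := m + z.
have hw : w' ^+ 2 <= 2 * z ^+ 2 + 2 * m ^+ 2.
  by have := sqr_ge0 (z - m); rewrite /w'; nra.
set L := 2 / 3 * ((5 + s) * w' + 5 * m).
have hL : L ^+ 2 <= 32 * w' ^+ 2 + 23 * m ^+ 2.
  have h1 : ((5 + s) * w' + 5 * m) ^+ 2 <= 2 * ((5 + s) * w') ^+ 2 + 2 * (5 * m) ^+ 2.
    by have := sqr_ge0 ((5 + s) * w' - 5 * m); nra.
  have h2 : ((5 + s) * w') ^+ 2 <= 36 * w' ^+ 2.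
    by rewrite exprMn; apply: ler_wpM2r; [exact: sqr_ge0|nra].
  have -> : L ^+ 2 = 4 / 9 * ((5 + s) * w' + 5 * m) ^+ 2 by rewrite /L; field.
  by have := sqr_ge0 w'; have := sqr_ge0 m; nra.
have hS : w' ^+ 4 <= 2 * (w' ^+ 2 + L) ^+ 2 + 2 * L ^+ 2.
  by have := sqr_ge0 (w' ^+ 2 + L + L); rewrite -[4%N]/(2 * 2)%N exprM; nra.
by have := sqr_ge0 (w' ^+ 2 + L); have := sqr_ge0 z; have := sqr_ge0 m; nra.
Qed.

(** The square of Q - m is discarded. The bound Z <= A uses up the whole gradient term, so a
    fraction t = 1/16000 of A is set aside for D through 4 D <= A; the missing t Z is at most 50 t
    Z2, well within the spare Z2/25. *)
Lemma coercivity_combination (R : realFieldType) (A J Q Z Z2 S2 W D m : R) :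
  0 <= D -> 4 * D <= A -> Z <= A -> Z <= 50 * Z2 -> 0 <= S2 -> 0 <= Z2 ->
  3 / 4 * S2 + 1 / 25 * Z2 + m ^+ 2 * (13 / 2) <= J + 10 * m * Q + Z + - (1 / 25) * Z2 ->
  W <= 4000 * (3 / 4 * S2 + 1 / 25 * Z2 + m ^+ 2 / 2 * 3) ->
  1 / 4000 * (D + W) <= A + J + 5 * Q ^+ 2.
Proof. by have := sqr_ge0 (Q - m); lra. Qed.

(** * Coercivity of the normalized dissipation *)

Section core.
Context {R : realType} (k : R) (u : R -> R).
Hypotheses (k0 : 0 < k) (ub : forall x, - 2 < u x < 1)
  (du : forall x : R, is_derive x (1 : R) u (k * ((u x + 2) * (1 - u x) ^+ 2)))
  (uNy : u x @[x --> -oo] --> (- 2 : R)) (uy : u x @[x --> +oo] --> (1 : R)).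
Local Notation mu := (@lebesgue_measure R).
Local Notation speed := (speed k u).

(** An algebra of functions containing u and w, all of whose members are integrable against [speed];
    every polynomial integrand in u, w and z is thereby integrable. *)
Definition bounded_measurable (f : R -> R) : Prop :=
  measurable_fun setT f /\ exists C, forall x, `|f x| <= C.

Lemma bounded_measurable_cst (c : R) : bounded_measurable (fun=> c).
Proof. by split => //; exists `|c|. Qed.

Lemma bounded_measurableD f g : bounded_measurable f -> bounded_measurable g ->
  bounded_measurable (fun x => f x + g x).
Proof.
move=> [mf [C fC]] [mg [D gD]]; split; first exact: measurable_funD.
by exists (C + D) => x; apply: (le_trans (ler_normD _ _)); exact: lerD.
Qed.

Lemma bounded_measurableM f g : bounded_measurable f -> bounded_measurable g ->
  bounded_measurable (fun x => f x * g x).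
Proof.
move=> [mf [C fC]] [mg [D gD]]; split; first exact: measurable_funM.
by exists (C * D) => x; rewrite normrM ler_pM.
Qed.

Lemma bounded_measurableN f : bounded_measurable f -> bounded_measurable (fun x => - f x).
Proof.
move=> [mf [C fC]]; split; first exact: measurable_funN.
by exists C => x; rewrite normrN.
Qed.

Lemma bounded_measurableX f n : bounded_measurable f ->
  bounded_measurable (fun x => f x ^+ n).
Proof.
move=> bf; elim: n => [|n ih]; first exact: bounded_measurable_cst.
by under eq_fun do rewrite exprS; exact: bounded_measurableM.
Qed.

Lemma bounded_measurable_profile : bounded_measurable u.
Proof.
split; first by apply: continuous_measurable_fun; exact: (profile_continuous du).
by exists 2 => x; have /andP[? ?] := ub x; rewrite ler_norml; apply/andP; split; lra.
Qed.

Lemma integrableR_speed_bounded f : bounded_measurable f ->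
  integrableR (fun x => speed x * f x).
Proof. by move=> [mf [C fC]]; exact: (integrableR_speedM k0 ub du uNy uy mf fC). Qed.

Lemma Rint_speedD f g : bounded_measurable f -> bounded_measurable g ->
  \int[mu]_x (speed x * (f x + g x)) =
  \int[mu]_x (speed x * f x) + \int[mu]_x (speed x * g x).
Proof.
move=> bf bg; rewrite -RintD; [|exact: integrableR_speed_bounded..].
by apply: eq_Rintegral => x _; rewrite mulrDr.
Qed.

Lemma Rint_speedZ (c : R) f : bounded_measurable f ->
  \int[mu]_x (speed x * (c * f x)) = c * \int[mu]_x (speed x * f x).
Proof.
move=> bf; rewrite -RintZ; last exact: integrableR_speed_bounded.
by apply: eq_Rintegral => x _; rewrite mulrCA.
Qed.

Lemma Rint_speed_le f g : bounded_measurable f -> bounded_measurable g ->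
  (forall x, f x <= g x) ->
  \int[mu]_x (speed x * f x) <= \int[mu]_x (speed x * g x).
Proof.
move=> bf bg fg; apply: Rint_le; try exact: integrableR_speed_bounded.
by move=> x; rewrite ler_wpM2l// ltW// (speed_gt0 k0 ub).
Qed.

Lemma normalized_coercivity (a m M : R) (d w : R -> R) : u a = - (4 / 5) ->
  measurable_fun setT d -> integrableR (fun x => d x ^+ 2) ->
  (forall x, w x = m + primitive a d x) -> (forall x, `|w x| <= M) ->
  1 / 4000 * (k^-1 * \int[mu]_x (d x ^+ 2) +
    \int[mu]_x (speed x * (w x ^+ 2 + w x ^+ 4))) <=
  \int[mu]_x ((5 - u x) / k * d x ^+ 2) +
  \int[mu]_x (speed x * ((15 * u x - 3) * w x ^+ 2 + (5 + u x) * w x ^+ 3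
     + 3 / 4 * w x ^+ 4)) +
  5 * (\int[mu]_x (speed x * ((5 - u x) * w x + 1 / 2 * w x ^+ 2))) ^+ 2.
Proof.
move=> ua md d2 wE wM; pose z := primitive a d.
have bu := bounded_measurable_profile; have bc := bounded_measurable_cst.
have mz : measurable_fun setT z by exact: measurable_primitive.
have bw : bounded_measurable w.
  split; last by exists M.
  by rewrite (_ : w = fun x => m + z x); [exact: measurable_funD|exact/funext].
have bz : bounded_measurable z.
  rewrite (_ : z = fun x => w x + - m); first exact: bounded_measurableD.
  by apply/funext => x; rewrite wE /z; ring.
have bmw : bounded_measurable (fun x => mixing_weight (u x)).
  split; first exact: measurable_mixing_weight du.
  by exists 50 => x; have /andP[? ?] := mixing_weight_profile ub x; rewrite ger0_norm.
have br : bounded_measurable (fun x => mean_density (u x)).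
  rewrite /mean_density.
  by repeat first [exact: bu | exact: bc | apply: bounded_measurableD |
    apply: bounded_measurableN | apply: bounded_measurableX | apply: bounded_measurableM].
pose S x := w x ^+ 2 + 2 / 3 * ((5 + u x) * w x + 5 * m).
pose P x := (15 * u x - 3) * w x ^+ 2 + (5 + u x) * w x ^+ 3 + 3 / 4 * w x ^+ 4.
pose q x := (5 - u x) * w x + 1 / 2 * w x ^+ 2.
have bS : bounded_measurable S.
  by repeat first [exact: bu | exact: bc | exact: bw | apply: bounded_measurableD |
    apply: bounded_measurableN | apply: bounded_measurableX | apply: bounded_measurableM].
have bP : bounded_measurable P.
  by repeat first [exact: bu | exact: bc | exact: bw | apply: bounded_measurableD |
    apply: bounded_measurableN | apply: bounded_measurableX | apply: bounded_measurableM].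
have bq : bounded_measurable q.
  by repeat first [exact: bu | exact: bc | exact: bw | apply: bounded_measurableD |
    apply: bounded_measurableN | apply: bounded_measurableX | apply: bounded_measurableM].
have bz2 : bounded_measurable (fun x => z x ^+ 2) by exact: bounded_measurableX.
have bS2 : bounded_measurable (fun x => S x ^+ 2) by exact: bounded_measurableX.
have bmz : bounded_measurable (fun x => mixing_weight (u x) * z x ^+ 2).
  exact: bounded_measurableM.
set A := \int[mu]_x ((5 - u x) / k * d x ^+ 2).
set J := \int[mu]_x (speed x * P x).
set Q := \int[mu]_x (speed x * q x).
pose Z := \int[mu]_x (speed x * (mixing_weight (u x) * z x ^+ 2)).
pose Z2 := \int[mu]_x (speed x * z x ^+ 2).
pose S2 := \int[mu]_x (speed x * S x ^+ 2).
pose W := \int[mu]_x (speed x * (w x ^+ 2 + w x ^+ 4)).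
have ZA : Z <= A.
  have -> : Z = \int[mu]_x (speed x * mixing_weight (u x) * z x ^+ 2).
    by apply: eq_Rintegral => x _; rewrite mulrA.
  apply: (weighted_poincare k0 ub du uNy uy ua md d2).
  by under eq_fun do rewrite -mulrA; exact: integrableR_speed_bounded.
have ZZ2 : Z <= 50 * Z2.
  rewrite /Z2 -Rint_speedZ//; apply: Rint_speed_le => //.
    exact: bounded_measurableM.
  by move=> x; have /andP[_ ?] := mixing_weight_profile ub x; rewrite ler_wpM2r ?sqr_ge0.
have [_ rR] := Rint_mean_density k0 ub du uNy uy.
have main : 3 / 4 * S2 + 1 / 25 * Z2 + m ^+ 2 * (13 / 2) <=
    J + 10 * m * Q + Z + - (1 / 25) * Z2.
  rewrite -rR /S2 /Z2 /J /Q /Z -!Rint_speedZ// -!Rint_speedD;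
    try by repeat first [assumption | exact: bc | apply: bounded_measurableD |
      apply: bounded_measurableM].
  apply: Rint_speed_le; try by repeat first [assumption | exact: bc |
      apply: bounded_measurableD | apply: bounded_measurableM].
  (* The square containing the cross term in m is dropped; the other terms of the identity are
     kept. *)
  move=> x; have := potential_sos (u x) (w x) m.
  have -> : w x - m = z x by rewrite wE /z; ring.
  rewrite -/(S x) -/(P x) => e.
  have h := sqr_ge0 ((16 - u x) * z x + 36 * (u x + 1) * m).
  have -> : q x = (5 - u x) * w x + w x ^+ 2 / 2 by rewrite /q; field.
  lra.
have WS : W <= 4000 * (3 / 4 * S2 + 1 / 25 * Z2 + m ^+ 2 / 2 * 3).
  (* The total mass of du is the length of ]-2, 1[; it turns the pointwise m^2/2 into the surplus
     13/2 - 5 = 3/2. *)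
  have V3 : \int[mu]_x (speed x * 1) = 3.
    have [||_] := @Rint_speed _ k u k0 ub du uNy uy id (cst 1).
    - by move=> s; exact: cvg_cst.
    - by move=> s _; rewrite /cst ler01.
    by move=> ->; ring.
  have b1 : bounded_measurable (fun x => 3 / 4 * S x ^+ 2) by exact: bounded_measurableM.
  have b2 : bounded_measurable (fun x => 1 / 25 * z x ^+ 2) by exact: bounded_measurableM.
  have b3 : bounded_measurable (fun=> m ^+ 2 / 2 * 1) by exact: bc.
  have b12 := bounded_measurableD b1 b2; have b123 := bounded_measurableD b12 b3.
  rewrite -[X in _ / 2 * X]V3 /S2 /Z2 -!Rint_speedZ// -!Rint_speedD//.
  rewrite -(Rint_speedZ _ b123); apply: Rint_speed_le.
  - by apply: bounded_measurableD; exact: bounded_measurableX.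
  - exact: bounded_measurableM.
  move=> x; apply: (le_trans (coercivity_pointwise (ub x) (wE x))).
  by rewrite -/(z x) -/(S x); lra.
have dA : 4 * (k^-1 * \int[mu]_x (d x ^+ 2)) <= A.
  rewrite mulrA -RintZ//; apply: Rint_le; first exact: integrableRZ.
    have bp : bounded_measurable (fun x => (5 - u x) * k^-1).
      by repeat first [exact: bu | exact: bc | apply: bounded_measurableD |
        apply: bounded_measurableN | apply: bounded_measurableM].
    by have [mp [C pC]] := bp; exact: (integrableR_boundedM mp pC).
  move=> x; have /andP[_ u2] := ub x.
  by rewrite ler_wpM2r ?sqr_ge0// ler_wpM2r ?invr_ge0 ?(ltW k0)//; lra.
have d0 : 0 <= k^-1 * \int[mu]_x (d x ^+ 2).
  by rewrite mulr_ge0 ?invr_ge0 ?(ltW k0)// Rintegral_ge0// => x _; exact: sqr_ge0.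
have S20 : 0 <= S2.
  by rewrite Rintegral_ge0// => x _; rewrite mulr_ge0 ?sqr_ge0// ltW// (speed_gt0 k0 ub).
have Z20 : 0 <= Z2.
  by rewrite Rintegral_ge0// => x _; rewrite mulr_ge0 ?sqr_ge0// ltW// (speed_gt0 k0 ub).
exact: (coercivity_combination d0 dA ZA ZZ2 S20 Z20 main WS).
Qed.

End core.

Theorem proposition4p2 (R : realType) (um : R) (U : R -> R) :
  0 < um -> is_shock_profile um U ->
  exists2 c : R, 0 < c &
    forall phi dphi : R -> R, is_H1 phi dphi ->
      c * (um * \int[lebesgue_measure]_x (dphi x ^+ 2)
           + \int[lebesgue_measure]_x
               (U^`()%classic x * (um ^+ 2 * phi x ^+ 2 + phi x ^+ 4)))
      <= dissipation0 um U phi dphi.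
Proof.
move=> um0 [Ub dU UNy Uy _]; have um1 : um != 0 by rewrite gt_eqF.
pose k := um ^+ 2; pose u x := U x / um.
have k0 : 0 < k by rewrite exprn_gt0.
have Uu x : U x = um * u x by rewrite /u mulrC divfK.
have ub x : - 2 < u x < 1.
  by have := Ub x; rewrite Uu => /andP[h1 h2]; apply/andP; split; rewrite -(ltr_pM2l um0); lra.
have du (x : R) : is_derive x (1 : R) u (k * ((u x + 2) * (1 - u x) ^+ 2)).
  have [dUx eU] := dU x; have dUx' : is_derive x (1 : R) U ((U x + 2 * um) * (U x - um) ^+ 2).
    by apply: DeriveDef => //; rewrite -derive1E.
  apply: (is_derive_eq (is_derive_mul dUx' (is_derive_cst um^-1 x (1 : R)))).
  by rewrite /cst Uu /k; field.
have uNy : u x @[x --> -oo] --> (- 2 : R).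
  have := cvgM UNy (cvg_cst um^-1); rewrite -mulrA divff// mulr1; exact.
have uy : u x @[x --> +oo] --> (1 : R).
  have := cvgM Uy (cvg_cst um^-1); rewrite divff//; exact.
have [a ua] : exists a, u a = - (4 / 5).
  by apply: (profile_attains k0 ub du uNy uy); apply/andP; split; lra.
have dUE x : U^`()%classic x = um * speed k u x.
  by have [_ ->] := dU x; rewrite Uu /speed /k; ring.
have meas_u : measurable_fun setT u.
  by apply: continuous_measurable_fun; exact: profile_continuous du.
have mU : measurable_fun setT U.
  by rewrite (_ : U = fun x => um * u x); [exact: measurable_funM|exact/funext].
have mdU : measurable_fun setT U^`()%classic.
  rewrite (_ : _^`()%classic = fun x => um * speed k u x); last exact/funext.
  apply: measurable_funM => //; apply: continuous_measurable_fun.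
  exact: speed_continuous du.
(* The constant does not depend on [um], since both sides are um^5 times their normalized
   counterparts. *)
exists (1 / 4000) => [|phi dphi [phiL dphiL wd]]; first by lra.
have mphi : measurable_fun setT phi by have := sub_Lfun_mfun phiL; rewrite inE.
have md : measurable_fun setT dphi by have := sub_Lfun_mfun dphiL; rewrite inE.
have phi2 : integrableR (fun x => phi x ^+ 2) := Lfun2_integrable_sqr phiL.
have d2 : integrableR (fun x => dphi x ^+ 2) := Lfun2_integrable_sqr dphiL.
have [m aem] := weak_derivative_representative a mphi phi2 md d2 wd.
have [M wM] := H1_bounded md d2 phi2 aem.
pose d x := um^-1 * dphi x; pose w x := (m + primitive a dphi x) / um.
have wE x : w x = m / um + primitive a d x.
  have -> : primitive a d x = um^-1 * primitive a dphi x.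
    rewrite /primitive -RintZ; last exact: integrableR_oriented_L2.
    by apply: eq_Rintegral => y _; rewrite /d mulrCA.
  by rewrite /w; ring.
have mw : measurable_fun setT w.
  by apply: measurable_funM => //; apply: measurable_funD => //; exact: measurable_primitive.
have aew : {ae lebesgue_measure, forall x, phi x = um * w x}.
  move: aem; apply: filterS; first exact: (ae_filter_ringOfSetsType lebesgue_measure).
  by move=> x /= ->; rewrite /w mulrC divfK.
have md' : measurable_fun setT d by exact: measurable_funM.
have d2' : integrableR (fun x => d x ^+ 2).
  by under eq_fun do rewrite /d exprMn; exact: integrableRZ.
have wM' x : `|w x| <= M / um.
  by rewrite /w normrM [`|um^-1|]gtr0_norm ?invr_gt0// ler_pM2r ?invr_gt0.
have bw : bounded_measurable w by split => //; exists (M / um).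
have bu := bounded_measurable_profile ub du.
have bc := @bounded_measurable_cst R.
have bm (f : R -> R) : bounded_measurable f -> measurable_fun setT f by case.
(* The relation phi = um w holds only almost everywhere, so the integrals, not the integrands, are
   identified; [n] is the degree of homogeneity in [um]. It is 3 for the integral that gets squared,
   and 5/um times um^6 again gives um^5. *)
have transfer (n : nat) (f g : R -> R) : measurable_fun setT f -> bounded_measurable g ->
    (forall x, phi x = um * w x -> f x = um ^+ n * (speed k u x * g x)) ->
    \int[lebesgue_measure]_x f x = um ^+ n * \int[lebesgue_measure]_x (speed k u x * g x).
  move=> mf bg fg; have ig := integrableR_speed_bounded k0 ub du uNy uy bg.
  rewrite -RintZ//; apply: Rint_ae => //.
    by apply: measurable_funM => //; exact: integrableR_measurable ig.
  move: aew; apply: filterS; first exact: (ae_filter_ringOfSetsType lebesgue_measure).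
  by move=> x /= /fg.
have e1 : um * \int[lebesgue_measure]_x (dphi x ^+ 2) =
    um ^+ 5 * (k^-1 * \int[lebesgue_measure]_x (d x ^+ 2)).
  have -> : \int[lebesgue_measure]_x (d x ^+ 2) =
      um ^- 2 * \int[lebesgue_measure]_x (dphi x ^+ 2).
    by rewrite -RintZ//; apply: eq_Rintegral => x _; rewrite /d exprMn exprVn.
  by rewrite /k; field.
have e2 : \int[lebesgue_measure]_x
      (U^`()%classic x * (um ^+ 2 * phi x ^+ 2 + phi x ^+ 4)) =
    um ^+ 5 * \int[lebesgue_measure]_x (speed k u x * (w x ^+ 2 + w x ^+ 4)).
  apply: transfer => [||x e].
  - apply: measurable_funM => //; apply: measurable_funD; last exact: measurable_funX.
    by apply: measurable_funM => //; exact: measurable_funX.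
  - by apply: bounded_measurableD; exact: bounded_measurableX.
  - by rewrite dUE e; ring.
have e3 : \int[lebesgue_measure]_x ((5 * um - U x) * dphi x ^+ 2) =
    um ^+ 5 * \int[lebesgue_measure]_x ((5 - u x) / k * d x ^+ 2).
  rewrite -RintZ; last first.
    have bp : bounded_measurable (fun x => (5 - u x) * k^-1).
      by apply: bounded_measurableM => //; apply: bounded_measurableD => //;
        exact: bounded_measurableN.
    by have [mp [C pC]] := bp; exact: (integrableR_boundedM mp pC).
  by apply: eq_Rintegral => x _; rewrite Uu /d /k; field.
have e4 : \int[lebesgue_measure]_x
      (U^`()%classic x * ((15 * um * U x - 3 * um ^+ 2) * phi x ^+ 2
                  + (5 * um + U x) * phi x ^+ 3 + 3 / 4 * phi x ^+ 4)) =
    um ^+ 5 * \int[lebesgue_measure]_x (speed k u x *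
      ((15 * u x - 3) * w x ^+ 2 + (5 + u x) * w x ^+ 3 + 3 / 4 * w x ^+ 4)).
  apply: transfer => [||x e].
  - by repeat first [assumption | exact: measurable_cst | apply: measurable_funM |
      apply: measurable_funD | apply: measurable_funN | apply: measurable_funX].
  - by repeat first [assumption | exact: bc | apply: bounded_measurableD |
      apply: bounded_measurableN | apply: bounded_measurableX | apply: bounded_measurableM].
  - by rewrite dUE e Uu; field.
have e5 : \int[lebesgue_measure]_x
      (U^`()%classic x * ((5 * um - U x) * phi x + 1 / 2 * phi x ^+ 2)) =
    um ^+ 3 * \int[lebesgue_measure]_x (speed k u x *
      ((5 - u x) * w x + 1 / 2 * w x ^+ 2)).
  apply: transfer => [||x e].
  - by repeat first [assumption | exact: measurable_cst | apply: measurable_funM |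
      apply: measurable_funD | apply: measurable_funN | apply: measurable_funX].
  - by repeat first [assumption | exact: bc | apply: bounded_measurableD |
      apply: bounded_measurableN | apply: bounded_measurableX | apply: bounded_measurableM].
  - by rewrite dUE e Uu; field.
have core := normalized_coercivity k0 ub du uNy uy ua md' d2' wE wM'.
rewrite -(ler_pM2l (exprn_gt0 5 um0)) in core.
rewrite /dissipation0 e1 e2 e3 e4 e5.
have scale D W : um ^+ 5 * (1 / 4000 * (D + W)) =
  1 / 4000 * (um ^+ 5 * D + um ^+ 5 * W) by ring.
rewrite scale in core; apply: (le_trans core).
by rewrite le_eqVlt; apply/orP; left; apply/eqP; field.
Qed.
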